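(* Let $A,B\in \mathbb{B}(\mathscr{H})$ be such that $|A|$ and $|B|$ are invertible, let $r>1$ and $s$ satisfy $\frac{1}{r}+\frac{1}{s}=1$, and let $p\in\mathbb{R}$. Then $$\big|A|A|^{p-1}-B|B|^{p-1}\big|^{2}\leq |A|^{p-1}\Big(r|A-B|^{2}+s\big||B|^{p}|A|^{1-p}-|B|\big|^2\Big)|A|^{p-1}.$$ Moreover, equality holds if and only if $$(r-1)(A-B)|A|^{p-1}=B(|A|^{p-1}-|B|^{p-1}).$$
   Context: $\mathscr{H}$ is a Hilbert space and $\mathbb{B}(\mathscr{H})$ is the algebra of bounded linear operators on $\mathscr{H}$. For $C\in\mathbb{B}(\mathscr{H})$, $|C|=(C^*C)^{1/2}$; real powers of positive (invertible) operators are taken via functional calculus. The inequality $\le$ is the usual order on self-adjoint operators. *)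

(* Defs.v *)
From HB Require Import structures.
From mathcomp Require Import all_boot all_order all_algebra.
From mathcomp Require Import sesquilinear complex.
From mathcomp Require Import all_classical all_reals all_analysis.

Set Implicit Arguments.
Unset Strict Implicit.
Unset Printing Implicit Defensive.

Import Order.TTheory GRing.Theory Num.Theory.
Import numFieldNormedType.Exports.

Local Open Scope classical_set_scope.
Local Open Scope ring_scope.
Local Open Scope complex_scope.

(* The form is linear in its first argument and conjugate-linear in the second;
   completeness is that of the underlying complex normed space. *)
HB.mixin Record isHilbert (R : realType) H of CompleteNormedModule R[i] H := {
  hdot : {dot H for @Num.conj R[i]};
  hdot_norm : forall x : H, hdot x x = `|x| ^+ 2
}.

#[short(type="hilbertType")]
HB.structure Definition Hilbert (R : realType) :=
  {H of isHilbert R H & CompleteNormedModule R[i] H}.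

Section BoundedOperators.
Context {R : realType} {H : hilbertType R}.

Definition bounded_operator : {pred H -> H} := fun f =>
  `[< linear f /\ exists M : R, forall x, `|f x| <= M%:C * `|x| >].

Record bop := Bop {
  bop_fun :> H -> H;
  bop_funP : bop_fun \in bounded_operator
}.

HB.instance Definition _ := [isSub for bop_fun].
HB.instance Definition _ := [Choice of bop by <:].

Lemma bop_linear (T : bop) : linear T.
Proof. by have /asboolP[] := bop_funP T. Qed.

Lemma bop_bounded (T : bop) : exists M : R, forall x, `|T x| <= M%:C * `|x|.
Proof. by have /asboolP[] := bop_funP T. Qed.

Lemma bopP (S T : bop) : (forall x, S x = T x) -> S = T.
Proof. by move=> ST; apply/val_inj/funext. Qed.

Lemma bounded_operator_submod : subsemimod_closed bounded_operator.
Proof.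
split; first split.
- apply/asboolP; split; first by move=> a x y; rewrite /GRing.zero/= scaler0 addr0.
  by exists 0 => x; rewrite normr0 mul0r.
- move=> f g /asboolP[lf [M fM]] /asboolP[lg [N gN]].
  apply/asboolP; split.
    by move=> a x y; rewrite !fctE lf lg scalerDr addrACA.
  exists (M + N) => x; rewrite !fctE (rmorphD (real_complex R)) mulrDl.
  exact: le_trans (ler_normD _ _) (lerD (fM x) (gN x)).
- move=> a f /asboolP[lf [M fM]]; apply/asboolP; split.
    by move=> b x y; rewrite !fctE lf scalerDr !scalerA mulrC.
  exists (complex.Re `|a| * M) => x.
  have aE : `|a| = (complex.Re `|a|)%:C by rewrite RRe_real// normr_real.
  rewrite !fctE normrZ {1}aE (rmorphM (real_complex R)) -mulrA.
  by rewrite ler_wpM2l// -aE.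
Qed.

HB.instance Definition _ :=
  GRing.SubChoice_isSubLmodule.Build _ _ _ bop bounded_operator_submod.

Lemma bounded_operator_id : (@idfun H) \in bounded_operator.
Proof. by apply/asboolP; split => //; exists 1 => x; rewrite mul1r. Qed.

Lemma bounded_operator_comp (S T : bop) :
  bop_fun S \o bop_fun T \in bounded_operator.
Proof.
apply/asboolP; split; first by move=> a x y /=; rewrite !bop_linear.
have [M SM] := bop_bounded S; have [N TN] := bop_bounded T.
exists (`|M| * N) => x /=; apply: (le_trans (SM _)).
apply: (@le_trans _ _ (`|M|%:C * `|T x|)).
  by rewrite ler_wpM2r// lecR ler_norm.
by rewrite (rmorphM (real_complex R)) -mulrA ler_wpM2l// lecR.
Qed.

Definition bop_one : bop := Bop bounded_operator_id.
Definition bop_mul (S T : bop) : bop := Bop (bounded_operator_comp S T).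

Lemma bop_mulA : associative bop_mul.
Proof. by move=> S T U; apply: bopP. Qed.

Lemma bop_mul1 : left_id bop_one bop_mul.
Proof. by move=> T; apply: bopP. Qed.

Lemma bop_mulr1 : right_id bop_one bop_mul.
Proof. by move=> T; apply: bopP. Qed.

Lemma bop_mulDl : left_distributive bop_mul +%R.
Proof. by move=> S T U; apply: bopP. Qed.

Lemma bop_mulDr : right_distributive bop_mul +%R.
Proof.
move=> S T U; apply: bopP => x.
by have := bop_linear S 1 (T x) (U x); rewrite !scale1r.
Qed.

(* Only a possibly zero ring: the space H may be zero. *)
HB.instance Definition _ := GRing.Zmodule_isPzRing.Build bop
  bop_mulA bop_mul1 bop_mulr1 bop_mulDl bop_mulDr.

Definition opnorm (T : bop) : R :=
  sup [set complex.Re `|T x| | x in [set x : H | `|x| <= 1]].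

Definition invertible (T : bop) : Prop :=
  exists S : bop, S * T = 1 /\ T * S = 1.

Definition is_adjoint (T T' : bop) : Prop :=
  forall x y : H, hdot (T x) y = hdot x (T' y).

(* The adjoint exists and is unique by the Riesz representation theorem. *)
Definition adjoint (T : bop) : bop := xget 0 [set T' | is_adjoint T T'].

Definition spectrum (T : bop) : set R[i] :=
  [set l | ~ invertible (T - l *: (1 : bop))].

(* The spectrum of a self-adjoint operator is real. *)
Definition real_spectrum (T : bop) : set R := [set t | spectrum T t%:C].

Definition opoly (q : {poly R}) (T : bop) : bop :=
  \sum_(k < size q) (q`_k)%:C *: T ^+ k.

(* S is f(T): the limit, in operator norm, of q_n(T) for real polynomials q_n
   that converge to f uniformly on the spectrum of T. For T self-adjoint and f
   continuous on the spectrum, there is exactly one such S. *)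
Definition is_cfc (f : R -> R) (T S : bop) : Prop :=
  exists q : nat -> {poly R},
    {uniform real_spectrum T, (fun n => horner (q n)) @ \oo --> f} /\
    opnorm (opoly (q n) T - S) @[n --> \oo] --> (0 : R).

Definition cfc (f : R -> R) (T : bop) : bop := xget 0 [set S | is_cfc f T S].

(* T^a for T positive and, when a < 0, invertible. *)
Definition opow (T : bop) (a : R) : bop := cfc (fun t => t `^ a) T.

Definition oabs (C : bop) : bop := opow (adjoint C * C) 2^-1.

(* Nonnegativity in R[i] includes being real. *)
Definition positive_op (T : bop) : Prop := forall x : H, 0 <= hdot (T x) x.

Definition ole (S T : bop) : Prop := positive_op (T - S).

End BoundedOperators.
Arguments bop {R} H.

(* Main.v *)
Require Import Defs.
From HB Require Import structures.
From mathcomp Require Import all_boot all_order all_algebra.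
From mathcomp Require Import sesquilinear complex.
From mathcomp Require Import all_classical all_reals all_analysis.
From mathcomp Require Import ring lra.

Set Implicit Arguments.
Unset Strict Implicit.
Unset Printing Implicit Defensive.

Import Order.TTheory GRing.Theory Num.Theory.
Import numFieldNormedType.Exports.

Local Open Scope ring_scope.
Local Open Scope complex_scope.

(** With X = |A|^(p-1) and Y = |B|^(p-1), put P = (A - B) X and Q = B (X - Y).
    Then A X - B Y = P + Q, and since |B| Y = |B|^p and |B|^2 = B^* B, the right-hand
    side is r P^* P + s Q^* Q. As (r - 1) (s - 1) = 1, the difference of the two sides
    is (r - 1)^-1 |(r - 1) P - Q|^2, which is nonnegative and vanishes exactly when
    (r - 1) P = Q.

    What this needs of the functional calculus of a self-adjoint T is that it is
    multiplicative and well defined, which both follow from ||q(T)|| <= sup |q|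
    over the spectrum of T for real polynomials q. Indeed S^2 - ||S||^2 is not
    invertible for S = q(T), so one of the factors T - l coming from the complex
    roots l of q^2 - ||S||^2 is not: |q| = ||S|| at a point of the spectrum. *)

(** [adjoint] and [cfc] pick a witness with default 0, so they carry no information until existence
    is proved. Adjoints, and inverses of coercive operators, come from a single variational
    argument, [lax_milgram]; the other invertibility criteria reduce to a coercive product of an
    operator with its adjoint.

    Existence of f(T) asks that f be a uniform limit of polynomials on the spectrum, which is proved
    on an interval containing it. Two kinds of interval occur. Since |C| must exist for every C, the
    square root is approximated down to 0; a power t^a with arbitrary real a is approximated only on
    [m, M] with m > 0, and invertibility supplies such an m.

    The space may be zero. Then every operator is invertible and all spectra are empty, so a point
    of the spectrum cannot be taken for granted. *)

Lemma ltr_invS (R : realType) (e : R) : 0 < e ->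
  exists N, forall n, (N <= n)%N -> (n.+1%:R^-1 : R) < e.
Proof.
move=> e0; exists (Num.truncn e^-1) => n Nn.
rewrite invf_plt ?posrE//; apply: lt_le_trans (truncnS_gt _) _.
by rewrite ler_nat.
Qed.

(** * Real part of the inner product, Cauchy-Schwarz and completeness *)

Section RealHilbert.
Context {R : realType} {H : hilbertType R}.
Implicit Types (x y z : H) (a : R).

(** Norm and form take values in the partially ordered field [R[i]]; their real parts allow
    estimates in [R], within reach of [lra], [nra] and [field]. *)
Definition rnorm x : R := complex.Re `|x|.
Definition rdot x y : R := complex.Re (hdot x y).

Lemma rnormE x : `|x| = (rnorm x)%:C.
Proof. by rewrite /rnorm RRe_real// normr_real. Qed.

Lemma rnorm_ge0 x : 0 <= rnorm x.
Proof. by rewrite -ler0c -rnormE. Qed.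

Lemma rnorm0 : rnorm 0 = 0.
Proof. by rewrite /rnorm normr0. Qed.

Lemma rnorm_eq0 x : (rnorm x == 0) = (x == 0).
Proof.
rewrite -[RHS]normr_eq0 rnormE; apply/eqP/eqP => [->//|h].
exact: (complexI h).
Qed.

Lemma rnormD x y : rnorm (x + y) <= rnorm x + rnorm y.
Proof. by rewrite -lecR rmorphD/= -!rnormE ler_normD. Qed.

Lemma rnormN x : rnorm (- x) = rnorm x.
Proof. by rewrite /rnorm normrN. Qed.

Lemma rnormB x y : rnorm (x - y) = rnorm (y - x).
Proof. by rewrite -rnormN opprB. Qed.

Lemma rnormZ (c : R[i]) x : rnorm (c *: x) = complex.Re `|c| * rnorm x.
Proof.
rewrite {1}/rnorm normrZ rnormE; case: (Num.norm c) => u v /=.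
by rewrite mulr0 subr0.
Qed.

Lemma rnormZr a x : rnorm (a%:C *: x) = `|a| * rnorm x.
Proof. by rewrite rnormZ normc_def /= expr0n/= addr0 sqrtr_sqr. Qed.

Lemma rdotxx x : rdot x x = rnorm x ^+ 2.
Proof. by rewrite /rdot hdot_norm rnormE -rmorphXn/=. Qed.

Lemma hdotC x y : hdot y x = (hdot x y)^*%C.
Proof. by rewrite (hermC hdot) expr0 mul1r. Qed.

Lemma rdotC x y : rdot x y = rdot y x.
Proof. by rewrite /rdot hdotC; case: (hdot _ _). Qed.

Lemma rdotDl x y z : rdot (x + y) z = rdot x z + rdot y z.
Proof. by rewrite /rdot linearDl raddfD. Qed.

Lemma rdotNl x z : rdot (- x) z = - rdot x z.
Proof. by rewrite /rdot linearNl raddfN. Qed.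

Lemma hdotZl (c : R[i]) x y : hdot (c *: x) y = c * hdot x y.
Proof. by rewrite linearZl_LR. Qed.

Lemma hdotZr (c : R[i]) x y : hdot x (c *: y) = c^*%C * hdot x y.
Proof. by rewrite hdotC hdotZl rmorphM [in RHS]hdotC. Qed.

Lemma rdotZl a x y : rdot (a%:C *: x) y = a * rdot x y.
Proof. by rewrite /rdot hdotZl; case: (hdot _ _) => u v /=; rewrite mul0r subr0. Qed.

Lemma rdotDr x y z : rdot x (y + z) = rdot x y + rdot x z.
Proof. by rewrite rdotC rdotDl !(rdotC x). Qed.

Lemma rdotNr x z : rdot x (- z) = - rdot x z.
Proof. by rewrite rdotC rdotNl rdotC. Qed.

Lemma rdotZr a x y : rdot x (a%:C *: y) = a * rdot x y.
Proof. by rewrite rdotC rdotZl rdotC. Qed.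

Lemma rdotBl x y z : rdot (x - y) z = rdot x z - rdot y z.
Proof. by rewrite rdotDl rdotNl. Qed.

Lemma rdotBr x y z : rdot x (y - z) = rdot x y - rdot x z.
Proof. by rewrite rdotDr rdotNr. Qed.

Lemma rdot0l x : rdot 0 x = 0.
Proof. by rewrite -(subrr x) rdotBl subrr. Qed.

Lemma rdot_inj x y : (forall z, rdot x z = rdot y z) -> x = y.
Proof.
move=> h; apply/eqP; rewrite -subr_eq0 -rnorm_eq0 -sqrf_eq0 -rdotxx rdotBl h subrr.
exact: eqxx.
Qed.

Lemma rdot_le x y : rdot x y <= rnorm x * rnorm y.
Proof.
have [->|x0] := eqVneq x 0; first by rewrite rdot0l rnorm0 mul0r.
have [->|y0] := eqVneq y 0; first by rewrite rdotC rdot0l rnorm0 mulr0.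
have hx : 0 < rnorm x by rewrite lt_def rnorm_ge0 rnorm_eq0 x0.
have hy : 0 < rnorm y by rewrite lt_def rnorm_ge0 rnorm_eq0 y0.
(* This square expands to [2 * |x| * |y| * (|x| * |y| - <x, y>)], with [<x, y>] the real part. *)
have := sqr_ge0 (rnorm ((rnorm y)%:C *: x - (rnorm x)%:C *: y)).
rewrite -rdotxx !(rdotBl, rdotBr, rdotZl, rdotZr) !rdotxx (rdotC y x) => h.
have hxy : 0 < rnorm x * rnorm y by apply: mulr_gt0.
rewrite -(ler_pM2l hxy); nra.
Qed.

Lemma rdot_norm_le x y : `|rdot x y| <= rnorm x * rnorm y.
Proof.
by rewrite ler_norml rdot_le andbT lerNl -rdotNl -(rnormN x) rdot_le.
Qed.

(** As [<i x, y> = i <x, y>], the imaginary part of the form is a real part too. Identities that are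
    stable under multiplication by [i] can thus be checked on [rdot]. *)
Lemma hdotE x y : hdot x y = rdot x y +i* - rdot ('i *: x) y.
Proof.
rewrite /rdot hdotZl; case: (hdot x y) => u v; congr (_ +i* _) => /=.
by rewrite mul0r mul1r sub0r opprK.
Qed.

Lemma rnorm_complete (u : nat -> H) :
  (forall e : R, 0 < e -> exists N : nat, forall m n : nat, (N <= m)%N -> (N <= n)%N ->
     rnorm (u m - u n) < e) ->
  exists l : H, forall e : R, 0 < e ->
    exists N : nat, forall n : nat, (N <= n)%N -> rnorm (u n - l) < e.
Proof.
move=> uC.
have cu : cvgn u.
  apply/cauchy_cvgP/cauchy_ballP => e e0.
  (* A positive element of [R[i]] is real. *)
  have eE : e = (complex.Re e)%:C by rewrite RRe_real// gtr0_real.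
  have [|N uN] := uC (complex.Re e); first by rewrite -ltcR -eE.
  pose A : set H := [set y | exists2 n, (N <= n)%N & y = u n]%classic.
  exists (A, A).
    by split; exists N => // n /= Nn; exists n.
  move=> [_ _] [/= [m Nm ->] [n Nn ->]].
  by rewrite -ball_normE /ball_/= rnormE eE ltcR uN.
exists (limn u) => e e0.
have e0' : (0 : R[i]) < e%:C by rewrite ltcR.
have /cvgrPdist_lt/(_ _ e0')[N _ uN] := cu.
exists N => n Nn; have := uN n Nn; rewrite rnormE ltcR; by rewrite rnormB.
Qed.

End RealHilbert.

(** * Lax-Milgram, adjoints, and inverses of coercive operators *)

Section BoundedOps.
Context {R : realType} {H : hilbertType R}.
Implicit Types (x y z : H) (a : R) (S T : bop H).

Lemma bopD T x y : T (x + y) = T x + T y.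
Proof. by have := bop_linear T 1 x y; rewrite !scale1r. Qed.

Lemma bop0 T : T 0 = 0.
Proof. by apply: (addrI (T 0)); rewrite -bopD !addr0. Qed.

Lemma bopZ T (c : R[i]) x : T (c *: x) = c *: T x.
Proof. by have := bop_linear T c x 0; rewrite bop0 !addr0. Qed.

Lemma bopN T x : T (- x) = - T x.
Proof. by rewrite -scaleN1r bopZ scaleN1r. Qed.

Lemma bopB T x y : T (x - y) = T x - T y.
Proof. by rewrite bopD bopN. Qed.

Lemma bop_rnorm_bounded T : exists2 M : R, 0 <= M &
  forall x, rnorm (T x) <= M * rnorm x.
Proof.
(* If the space is zero, the given bound may be negative. *)
have [M TM] := bop_bounded T; exists `|M| => // x.
apply: (@le_trans _ _ (M * rnorm x)).
  by have := TM x; rewrite !rnormE -rmorphM lecR.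
by rewrite ler_wpM2r ?rnorm_ge0 ?ler_norm.
Qed.

Lemma bop_of_linear (f : H -> H) (M : R) : linear f ->
  (forall x, rnorm (f x) <= M * rnorm x) -> exists T : bop H, forall x, T x = f x.
Proof.
move=> lf fM.
have fb : f \in @bounded_operator R H.
  apply/asboolP; split => //; exists M => x.
  by rewrite !rnormE -rmorphM lecR.
by exists (Bop fb).
Qed.

Lemma rdotZC (c : R[i]) x y : rdot (c *: x) y = rdot x (c^*%C *: y).
Proof. by rewrite /rdot hdotZl hdotZr conjcK. Qed.

Lemma is_adjointP S T : is_adjoint S T <-> forall x y, rdot (S x) y = rdot x (T y).
Proof.
split=> [h x y|h x y]; first by rewrite /rdot h.
by rewrite !hdotE -bopZ !h.
Qed.

(* Minimize J x = <N x, x> - 2 f x: by the parallelogram identity a minimizing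
   sequence is Cauchy, and the first variation of J vanishes at its limit. *)
Lemma lax_milgram (N : bop H) (m K : R) (f : H -> R) :
  is_adjoint N N -> 0 < m -> (forall x, m * rnorm x ^+ 2 <= rdot (N x) x) ->
  (forall x y, f (x + y) = f x + f y) -> (forall a x, f (a%:C *: x) = a * f x) ->
  (forall x, f x <= K * rnorm x) ->
  exists x, forall y, rdot (N x) y = f y.
Proof.
move=> /is_adjointP Nsym m0 Ncoer fD fZ fK.
pose J x := rdot (N x) x - 2 * f x.
have Jlb x : - (K ^+ 2 / m) <= J x.
  have h1 := Ncoer x; have h2 := fK x.
  (* Completing the square in [m t^2 - 2 K t] at [t = rnorm x] yields the lower bound. *)
  have : 0 <= (m * rnorm x - K) ^+ 2 / m by rewrite divr_ge0 ?sqr_ge0 ?ltW.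
  have -> : (m * rnorm x - K) ^+ 2 / m =
      m * rnorm x ^+ 2 - 2 * K * rnorm x + K ^+ 2 / m.
    by field; rewrite gt_eqF.
  by rewrite /J => *; lra.
have Jinf : has_inf (range J).
  split; first by exists (J 0), 0.
  by exists (- (K ^+ 2 / m)) => _ [x _ <-].
have [I IJ Iadh] : exists2 I : R, forall x, I <= J x &
    forall e, 0 < e -> exists x, J x < I + e.
  exists (inf (range J)) => [x|e e0]; first by apply: ge_inf; [case: Jinf | exists x].
  by have [_ [x _ <-] xI] := inf_adherent e0 Jinf; exists x.
(* [J x + J y - 2 * J ((x + y) / 2)] is half of [<N (x - y), x - y>], and [I] bounds [J] at the
   midpoint. *)
have Jpar x y : m * rnorm (x - y) ^+ 2 <= 2 * (J x + J y - 2 * I).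
  pose h : R := 2^-1.
  have := IJ (h%:C *: (x + y)); have := Ncoer (x - y).
  rewrite /J /h bopB bopZ bopD.
  rewrite !(rdotBl, rdotBr, rdotZl, rdotZr, rdotDl, rdotDr, fD, fZ).
  rewrite (rdotC (N x) y) -(Nsym y x) => *; lra.
have exu n : exists x, J x < I + n.+1%:R^-1.
  by apply: Iadh; rewrite invr_gt0.
have [u uI] := boolp.choice exu.
have [|l ul] := @rnorm_complete _ _ u.
  move=> e e0; have [|k kP] := @ltr_invS R (m * e ^+ 2 / 4).
    by rewrite divr_gt0// mulr_gt0// exprn_gt0.
  exists k => i j ki kj.
  rewrite -(@ltr_pXn2r _ 2)// ?nnegrE ?rnorm_ge0 ?ltW//.
  rewrite -(ltr_pM2l m0).
  have hk n : (k <= n)%N -> J (u n) < I + m * e ^+ 2 / 4.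
    by move=> kn; apply: lt_trans (uI n) _; rewrite ltrD2l kP.
  by have := Jpar (u i) (u j); have := hk _ ki; have := hk _ kj => *; lra.
exists l => y.
pose g := rdot (N l) y - f y; pose c := rdot (N y) y.
have c0 : 0 <= c.
  by apply: le_trans (Ncoer y); rewrite mulr_ge0 ?sqr_ge0 ?ltW.
(* The expansion is made at [u n], where [J] is within [e / 2] of its infimum. Only the linear term
   is then moved from [N (u n)] to [N l], at the cost of another [e / 2], so that continuity of [J]
   does not come up. *)
have var t : 0 <= 2 * t * g + t ^+ 2 * c.
  apply/ler_addgt0Pr => e e0.
  have [|k1 k1P] := @ltr_invS R (e / 2); first by rewrite divr_gt0.
  pose C := 2 * `|t| * rnorm (N y) + 1.
  have C0 : 0 < C by rewrite ltr_wpDl// !mulr_ge0 ?rnorm_ge0.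
  have [|k2 k2P] := ul (e / 2 / C); first by rewrite !divr_gt0.
  pose n := maxn k1 k2.
  have h1 := k1P n (leq_maxl _ _); have h2 := k2P n (leq_maxr _ _).
  have := IJ (u n + t%:C *: y).
  have : J (u n) < I + e / 2 by apply: lt_trans (uI n) _; rewrite ltrD2l.
  rewrite /J bopD bopZ !(rdotDl, rdotDr, rdotZl, rdotZr, fD, fZ) -/c.
  rewrite (rdotC (N y)) -(Nsym (u n) y) => h3 h4.
  have h5 : `|2 * t * (rdot (N (u n)) y - rdot (N l) y)| <= e / 2.
    rewrite -rdotBl -bopB Nsym !normrM normr_nat.
    apply: (@le_trans _ _ (2 * `|t| * (rnorm (u n - l) * rnorm (N y)))).
      by rewrite ler_wpM2l ?mulr_ge0// rdot_norm_le.
    have h6 : rnorm (u n - l) * C <= e / 2 by rewrite -ler_pdivlMr// ltW.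
    apply: le_trans h6; rewrite /C; have := rnorm_ge0 (u n - l) => *; lra.
  have {h5} := ler_normlW h5; rewrite /g => *; lra.
(* The minimizing [t] is [- g / c]; the denominator [c + 1] avoids a case distinction on [c = 0] and
   still makes the value a negative multiple of [g ^+ 2]. *)
have := var (- g / (c + 1)).
have -> : 2 * (- g / (c + 1)) * g + (- g / (c + 1)) ^+ 2 * c
    = - (g ^+ 2 * ((c + 2) / (c + 1) ^+ 2)).
  by field; rewrite gt_eqF// ltr_wpDl.
have q0 : 0 < (c + 2) / (c + 1) ^+ 2.
  by rewrite divr_gt0 ?exprn_gt0 ?ltr_wpDl.
rewrite oppr_ge0 pmulr_lle0// => g2.
have : g ^+ 2 == 0 by rewrite eq_le g2 sqr_ge0.
by rewrite sqrf_eq0 subr_eq0 => /eqP.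
Qed.

Lemma is_adjoint_sym S T : is_adjoint S T -> is_adjoint T S.
Proof. by move=> h x y; rewrite hdotC -h -hdotC. Qed.

Lemma is_adjoint_uniq S T T' : is_adjoint S T -> is_adjoint S T' -> T = T'.
Proof.
move=> /is_adjointP h /is_adjointP h'; apply: bopP => x; apply: rdot_inj => z.
by rewrite rdotC -h h' rdotC.
Qed.

Lemma is_adjoint1 : is_adjoint (1 : bop H) 1.
Proof. by []. Qed.

Lemma is_adjointD S S' T T' :
  is_adjoint S S' -> is_adjoint T T' -> is_adjoint (S + T) (S' + T').
Proof. by move=> h h' x y; rewrite /= linearDl linearDr/= h h'. Qed.

Lemma is_adjointZ (c : R[i]) S S' :
  is_adjoint S S' -> is_adjoint (c *: S) (c^*%C *: S').
Proof. by move=> h x y; rewrite /= hdotZl hdotZr conjcK h. Qed.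

Lemma is_adjointM S S' T T' :
  is_adjoint S S' -> is_adjoint T T' -> is_adjoint (S * T) (T' * S').
Proof. by move=> h h' x y; rewrite /= h h'. Qed.

(** Riesz representation is [lax_milgram] with [N = 1], applied to [z |-> rdot (T z) y]. Complex
    linearity of the representing map [f] follows from nondegeneracy, and its bound from [|f y|^2 =
    rdot (T (f y)) y <= M |f y| |y|]. *)
Lemma adjointP T : is_adjoint T (adjoint T).
Proof.
rewrite /adjoint; apply: (@xgetPex _ _ [set T' | is_adjoint T T']%classic).
have [M M0 TM] := bop_rnorm_bounded T.
have ex y : exists x, forall z, rdot x z = rdot (T z) y.
  have [||a x||x xP] := @lax_milgram 1 1 (M * rnorm y) (fun z => rdot (T z) y)
    is_adjoint1 ltr01.
  - by move=> x; rewrite mul1r -rdotxx.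
  - by move=> x z; rewrite bopD rdotDl.
  - by rewrite bopZ rdotZl.
  - move=> x; rewrite mulrAC; apply: le_trans (rdot_le _ _) _.
    by rewrite ler_wpM2r ?rnorm_ge0.
  by exists x.
have [f fP] := boolp.choice ex.
have [||T' T'E] := @bop_of_linear f M.
- move=> c x y; apply: rdot_inj => z.
  by rewrite rdotDl rdotZC !fP rdotDr bopZ rdotZC conjcK.
- move=> y; have [fy0|fy0] := eqVneq (f y) 0.
    by rewrite fy0 rnorm0 mulr_ge0 ?rnorm_ge0.
  have fy : 0 < rnorm (f y) by rewrite lt_def rnorm_ge0 rnorm_eq0 fy0.
  rewrite -(ler_pM2l fy) -expr2 -rdotxx fP mulrA [rnorm _ * M]mulrC.
  by apply: le_trans (rdot_le _ _) _; rewrite ler_wpM2r ?rnorm_ge0.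
by exists T' => /=; apply/is_adjointP => x y; rewrite T'E [RHS]rdotC fP.
Qed.

(** [lax_milgram] gives surjectivity and coercivity gives injectivity. With [N (f y) = y], the
    estimate [m |f y|^2 <= rdot y (f y) <= |y| |f y|] bounds the inverse by [m^-1]. *)
Lemma coercive_invertible (N : bop H) (m : R) :
  is_adjoint N N -> 0 < m -> (forall x, m * rnorm x ^+ 2 <= rdot (N x) x) ->
  invertible N.
Proof.
move=> Nsa m0 Ncoer.
have ex z : exists x, N x = z.
  have [|||x xP] := @lax_milgram N m (rnorm z) (fun y => rdot z y) Nsa m0 Ncoer.
  - exact: rdotDr.
  - by move=> a x; rewrite rdotZr.
  - exact: rdot_le.
  by exists x; apply: rdot_inj.
have [f fP] := boolp.choice ex.
have Ninj x y : N x = N y -> x = y.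
  move=> /eqP; rewrite -subr_eq0 -bopB => /eqP e.
  have := Ncoer (x - y); rewrite e rdot0l pmulr_rle0// => h.
  apply/eqP; rewrite -subr_eq0 -rnorm_eq0 -sqrf_eq0.
  by rewrite eq_le h sqr_ge0.
have [||V VE] := @bop_of_linear f m^-1.
- by move=> c x y; apply: Ninj; rewrite fP bopD bopZ !fP.
- move=> y; have [fy0|fy0] := eqVneq (f y) 0.
    by rewrite fy0 rnorm0 mulr_ge0 ?rnorm_ge0 ?invr_ge0 ?ltW.
  have fy : 0 < rnorm (f y) by rewrite lt_def rnorm_ge0 rnorm_eq0 fy0.
  rewrite mulrC ler_pdivlMr// mulrC -(ler_pM2r fy) -mulrA -expr2.
  by apply: le_trans (Ncoer _) _; rewrite fP rdot_le.
exists V; split; apply: bopP => x /=; rewrite VE ?fP//.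
by apply: Ninj; rewrite fP.
Qed.

End BoundedOps.

(** * Polynomials in an operator *)

Section PolynomialCalculus.
Context {R : realType} {H : hilbertType R}.
Implicit Types (x y z : H) (S T U V : bop H) (P Q : {poly R[i]}).

Lemma bopE0 x : (0 : bop H) x = 0. Proof. by []. Qed.
Lemma bopE1 x : (1 : bop H) x = x. Proof. by []. Qed.
Lemma bopED S T x : (S + T) x = S x + T x. Proof. by []. Qed.
Lemma bopEN T x : (- T) x = - T x. Proof. by []. Qed.
Lemma bopEB S T x : (S - T) x = S x - T x. Proof. by []. Qed.
Lemma bopEM S T x : (S * T) x = S (T x). Proof. by []. Qed.
Lemma bopEZ (c : R[i]) T x : (c *: T) x = c *: T x. Proof. by []. Qed.

Lemma bop_scalerAl (c : R[i]) S T : c *: (S * T) = (c *: S) * T.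
Proof. exact: bopP. Qed.

Lemma bop_scalerAr (c : R[i]) S T : c *: (S * T) = S * (c *: T).
Proof. by apply: bopP => x; rewrite !(bopEM, bopEZ) bopZ. Qed.

Lemma invertibleM S T : invertible S -> invertible T -> invertible (S * T).
Proof.
move=> [S' [S'S SS']] [T' [T'T TT']]; exists (T' * S').
by rewrite mulrA -(mulrA T') S'S mulr1 T'T mulrA -(mulrA S) TT' mulr1 SS'.
Qed.

Lemma invertible1 : invertible (1 : bop H).
Proof. by exists 1; rewrite mulr1. Qed.

Lemma invertibleZ (c : R[i]) T : c != 0 -> invertible T -> invertible (c *: T).
Proof.
move=> c0 [S [ST TS]]; exists (c^-1 *: S).
by rewrite -!bop_scalerAl -!bop_scalerAr ST TS !scalerA mulVf// mulfV// scale1r.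
Qed.

(** [V * W] is a right inverse of [U] at once. It is also a left inverse as soon as [V] commutes
    with [W], since [W * V * U = W * U * V = 1]. *)
Lemma invertible_commM U V : U * V = V * U -> invertible (U * V) -> invertible U.
Proof.
move=> UV [W [WUV UVW]]; exists (V * W); rewrite mulrA UVW; split=> //.
(* [V W = W (U V) V W = W V (U V W) = W V]. *)
have -> : V * W = W * V.
  by rewrite -[LHS]mul1r -WUV -[W * _ * _]mulrA [U * V in LHS]UV -mulrA
    [U * _]mulrA UVW mulr1.
by rewrite -mulrA -UV.
Qed.

(* U V = U U^* is coercive. *)
Lemma normal_invertible U V (c : R) : is_adjoint U V -> U * V = V * U ->
  0 < c -> (forall x, c * rnorm x <= rnorm (V x)) -> invertible U.
Proof.
move=> adj UV c0 Vc; apply: (invertible_commM UV).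
apply: (@coercive_invertible _ _ _ (c ^+ 2)).
- exact: is_adjointM (is_adjoint_sym adj).
- by rewrite exprn_gt0.
- move=> x; rewrite bopEM ((is_adjointP _ _).1 adj) rdotxx -exprMn.
  by apply: lerXn2r (Vc x); rewrite nnegrE ?mulr_ge0 ?rnorm_ge0 ?ltW.
Qed.

(** The coefficients are complex, unlike those of [opoly], because the splitting into linear factors
    takes place over [R[i]]. *)
Definition cev P T : bop H := \sum_(k < size P) P`_k *: T ^+ k.

Lemma cev_widen n P T : (size P <= n)%N -> cev P T = \sum_(k < n) P`_k *: T ^+ k.
Proof.
move=> Pn; rewrite /cev (big_ord_widen _ (fun k => P`_k *: T ^+ k) Pn) big_mkcond.
apply: eq_bigr => k _; case: ltnP => // Pk.
by rewrite nth_default// scale0r.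
Qed.

Lemma cevD P Q T : cev (P + Q) T = cev P T + cev Q T.
Proof.
rewrite !(@cev_widen (maxn (size P) (size Q))) ?leq_maxl ?leq_maxr ?size_polyD//.
by rewrite -big_split; apply: eq_bigr => k _; rewrite coefD scalerDl.
Qed.

Lemma cevZ (c : R[i]) P T : cev (c *: P) T = c *: cev P T.
Proof.
rewrite (@cev_widen (size P)) ?size_scale_leq// scaler_sumr.
by apply: eq_bigr => k _; rewrite coefZ scalerA.
Qed.

Lemma cevC (c : R[i]) T : cev c%:P T = c *: (1 : bop H).
Proof.
by rewrite (@cev_widen 1) ?size_polyC_leq1// big_ord1 coefC expr0.
Qed.

Lemma cevMX P T : cev (P * 'X) T = cev P T * T.
Proof.
rewrite (@cev_widen (size P).+1); last first.
  by apply: leq_trans (size_polyMleq _ _) _; rewrite size_polyX addn2.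
rewrite big_ord_recl coefMX eqxx scale0r add0r mulr_suml.
apply: eq_bigr => k _; rewrite coefMX lift0/= -bop_scalerAl.
by rewrite exprSr.
Qed.

Lemma cevX T : cev 'X T = T.
Proof. by rewrite -[X in cev X]mul1r cevMX cevC scale1r mul1r. Qed.

Lemma cev_comm P T : T * cev P T = cev P T * T.
Proof.
rewrite mulr_sumr mulr_suml; apply: eq_bigr => k _.
by rewrite -bop_scalerAl -bop_scalerAr -exprS exprSr.
Qed.

Lemma cevM P Q T : cev (P * Q) T = cev P T * cev Q T.
Proof.
elim/poly_ind: P Q => [|P c IH] Q.
  by rewrite mul0r {1 2}/cev size_poly0 !big_ord0 mul0r.
rewrite mulrDl mul_polyC -mulrA cevD IH cevZ [_ * Q]mulrC cevMX -cev_comm.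
by rewrite cevD cevMX cevC mulrDl -bop_scalerAl mul1r mulrA.
Qed.

Lemma opolyE (q : {poly R}) T : opoly q T = cev (map_poly (real_complex R) q) T.
Proof.
rewrite /opoly (@cev_widen (size q)) ?size_map_poly//.
by apply: eq_bigr => k _; rewrite coef_map.
Qed.

Lemma opolyM (p q : {poly R}) T : opoly (p * q) T = opoly p T * opoly q T.
Proof. by rewrite !opolyE rmorphM cevM. Qed.

Lemma opolyD (p q : {poly R}) T : opoly (p + q) T = opoly p T + opoly q T.
Proof. by rewrite !opolyE rmorphD cevD. Qed.

Lemma opolyC (c : R) T : opoly c%:P T = c%:C *: (1 : bop H).
Proof. by rewrite opolyE map_polyC cevC. Qed.

Lemma opolyX T : opoly 'X T = T.
Proof. by rewrite opolyE map_polyX cevX. Qed.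

Lemma opolyN (p : {poly R}) T : opoly (- p) T = - opoly p T.
Proof.
apply: (addIr (opoly p T)); rewrite -opolyD !addNr.
by rewrite /opoly size_poly0 big_ord0.
Qed.

Lemma opolyB (p q : {poly R}) T : opoly (p - q) T = opoly p T - opoly q T.
Proof. by rewrite opolyD opolyN. Qed.

Lemma is_adjointX T n : is_adjoint T T -> is_adjoint (T ^+ n) (T ^+ n).
Proof.
move=> Tsa; elim: n => [//|n IH]; rewrite {1}exprS exprSr.
exact: is_adjointM.
Qed.

Lemma opoly_selfadj (q : {poly R}) T : is_adjoint T T ->
  is_adjoint (opoly q T) (opoly q T).
Proof.
move=> Tsa; rewrite /opoly; elim/big_ind: _ => [x y|U V|k _].
- by rewrite bopE0 linear0l linear0r.
- exact: is_adjointD.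
- have := @is_adjointZ _ _ (q`_k)%:C _ _ (is_adjointX k Tsa).
  by rewrite conjc_real.
Qed.

Lemma cev_root_spectrum P T : P != 0 -> ~ invertible (cev P T) ->
  exists2 l, root P l & spectrum T l.
Proof.
move=> P0 nP; apply: contrapT => no; apply: nP.
have [rs Prs] := closed_field_poly_normal P.
rewrite Prs cevZ; apply: invertibleZ; first by rewrite lead_coef_eq0.
have : forall l, l \in rs -> invertible (T - l *: (1 : bop H)).
  move=> l lrs; apply: contrapT => nl; apply: no; exists l => //.
  by rewrite Prs rootZ ?lead_coef_eq0// root_prod_XsubC.
elim: rs {Prs} => [|l rs IH] inv.
  by rewrite big_nil cevC scale1r; exact: invertible1.
rewrite big_cons cevM; apply: invertibleM.
  have -> : 'X - l%:P = 'X + (- l)%:P by rewrite polyCN.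
  by rewrite cevD cevX cevC scaleNr; apply: inv; rewrite mem_head.
by apply: IH => k krs; apply: inv; rewrite in_cons krs orbT.
Qed.

(** [<T x, x>] is real, hence [<T x, i x>] is purely imaginary. This removes the cross term in
    [selfadj_spectrum_real]. *)
Lemma selfadj_rdot_i T x : is_adjoint T T -> rdot (T x) ('i *: x) = 0.
Proof.
move=> /is_adjointP Tsa.
have : rdot (T x) ('i *: x) = - rdot (T x) ('i *: x).
  rewrite {1}rdotC rdotZC.
  have -> : 'i^*%C = - 'i :> R[i] by apply/eqP; rewrite eq_complex /= oppr0 !eqxx.
  by rewrite scaleNr rdotNr Tsa bopZ.
move: (rdot _ _) => a aN; lra.
Qed.

End PolynomialCalculus.

(** * Reality of the spectrum and the norm of a polynomial in T *)

Section SpectralBound.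
Context {R : realType} {H : hilbertType R}.
Implicit Types (x y z : H) (S T U V : bop H).

Lemma selfadj_bounded_below_invertible T (c : R) : is_adjoint T T -> 0 < c ->
  (forall x, c * rnorm x <= rnorm (T x)) -> invertible T.
Proof. by move=> Tsa c0 Tc; exact: (@normal_invertible _ _ T T c). Qed.

Lemma selfadj_shift (a : R) T : is_adjoint T T ->
  is_adjoint (T - a%:C *: (1 : bop H)) (T - a%:C *: (1 : bop H)).
Proof.
move=> Tsa; rewrite -scaleNr; apply: is_adjointD => //.
have := is_adjointZ (- a)%:C (@is_adjoint1 R H).
by rewrite conjc_real rmorphN.
Qed.

(** For [S = T - a] and real [b], the operator [S - i b] is normal with adjoint [S + i b], and
    [|(S + i b) x|^2 = |S x|^2 + b^2 |x|^2], so it is invertible when [b] is nonzero. *)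
Lemma selfadj_spectrum_real T (l : R[i]) : is_adjoint T T -> spectrum T l ->
  l = (complex.Re l)%:C.
Proof.
move=> Tsa; case: l => a b /= sl.
have [->//|b0] := eqVneq b 0; exfalso; apply: sl.
pose S := T - a%:C *: (1 : bop H).
have Ssa : is_adjoint S S by exact: selfadj_shift.
have -> : T - (a +i* b) *: (1 : bop H) = S + (0 -i* b) *: (1 : bop H).
  rewrite /S -addrA -!scaleNr -scalerDl; congr (_ + _ *: _).
  by apply/eqP; rewrite eq_complex /= oppr0 addr0 add0r !eqxx.
move: (S) Ssa => {}S Ssa.
apply: (@normal_invertible _ _ _ (S + (0 +i* b) *: (1 : bop H)) `|b|).
- apply: is_adjointD => //.
  have := is_adjointZ (0 -i* b) (@is_adjoint1 R H).
  by rewrite /= opprK.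
- have mulE (V : bop H) (c d : R[i]) : (V + c *: (1 : bop H)) * (V + d *: (1 : bop H)) =
      V * V + (c + d) *: V + (c * d) *: (1 : bop H).
    rewrite mulrDl !mulrDr -!bop_scalerAr -!bop_scalerAl !mulr1 mul1r !scalerA.
    by rewrite scalerDl -!addrA; congr (_ + _); rewrite addrCA [d * c]mulrC.
  by rewrite !mulE [0 -i* b + _]addrC [(0 -i* b) * _]mulrC.
- by rewrite normr_gt0.
move=> x; rewrite bopED bopEZ bopE1.
rewrite -ler_sqr ?nnegrE ?mulr_ge0 ?rnorm_ge0// -[X in _ <= X]rdotxx.
have -> : (0 +i* b) *: x = b%:C *: ('i *: x).
  rewrite scalerA; congr (_ *: _); apply/eqP.
  by rewrite eq_complex /= !(mul0r, mulr0, mulr1) subr0 addr0 !eqxx.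
have nix : rnorm ('i *: x : H) = rnorm x.
  by rewrite rnormZ normc_def /= expr0n expr1n /= add0r sqrtr1 mul1r.
rewrite !(rdotDl, rdotDr, rdotZl, rdotZr) (rdotC ('i *: x)).
rewrite selfadj_rdot_i// !rdotxx nix.
rewrite exprMn real_normK ?num_real// !mulr0 addr0 add0r mulrA -expr2.
by rewrite lerDr sqr_ge0.
Qed.

Lemma opnorm_has_sup T :
  has_sup [set complex.Re `|T x| | x in [set x : H | `|x| <= 1]]%classic.
Proof.
split; first by exists (rnorm (T 0)), 0 => //=; rewrite normr0.
have [M M0 TM] := bop_rnorm_bounded T; exists M => _ [x /= x1 <-].
apply: le_trans (TM x) _; rewrite -[leRHS]mulr1 ler_wpM2l//.
by rewrite -lecR -rnormE.
Qed.

Lemma opnorm_ge0 T : 0 <= opnorm T.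
Proof.
apply: le_trans (rnorm_ge0 (T 0)) _; apply: ub_le_sup.
  by case: (opnorm_has_sup T).
by exists 0 => //=; rewrite normr0.
Qed.

Lemma rnorm_opnorm T x : rnorm (T x) <= opnorm T * rnorm x.
Proof.
have [->|x0] := eqVneq x 0; first by rewrite bop0 rnorm0 mulr0.
have hx : 0 < rnorm x by rewrite lt_def rnorm_ge0 rnorm_eq0 x0.
rewrite -ler_pdivrMr// mulrC -[(rnorm x)^-1]ger0_norm ?invr_ge0 ?rnorm_ge0//.
rewrite -rnormZr -bopZ; apply: ub_le_sup; first by case: (opnorm_has_sup T).
exists (((rnorm x)^-1)%:C *: x) => //=.
rewrite rnormE rnormZr ger0_norm ?invr_ge0 ?rnorm_ge0// mulVf ?rnorm_eq0//.
Qed.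

Lemma opnorm_le T (c : R) : 0 <= c -> (forall x, rnorm (T x) <= c * rnorm x) ->
  opnorm T <= c.
Proof.
move=> c0 Tc; apply: ge_sup; first by case: (opnorm_has_sup T).
move=> _ [x /= x1 <-]; apply: le_trans (Tc x) _.
by rewrite -[leRHS]mulr1 ler_wpM2l// -lecR -rnormE.
Qed.

Lemma opnorm_eq0 T : opnorm T = 0 -> T = 0.
Proof.
move=> T0; apply: bopP => x; apply/eqP; rewrite bopE0 -rnorm_eq0.
by have := rnorm_opnorm T x; rewrite T0 mul0r eq_le rnorm_ge0 andbT.
Qed.

(* ||S x|| <= ||S|| ||x|| is nearly attained, so S^2 - ||S||^2 is not bounded below. *)
Lemma selfadj_opnorm_not_invertible S : is_adjoint S S -> 0 < opnorm S ->
  ~ invertible (S * S - (opnorm S ^+ 2)%:C *: (1 : bop H)).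
Proof.
move=> /is_adjointP Ssa; set v := opnorm S => v0 [W [WN _]].
have [M M0 WM] := bop_rnorm_bounded W.
(* An inverse bounded by [M] gives [|x|^2 <= (M + 1)^2 |N x|^2] for [N = S^2 - v^2], and
   [|S (S x)| <= v |S x|] gives [|N x|^2 <= v^2 (v^2 |x|^2 - |S x|^2)]. The product of the two
   constants is [K]; [M + 1] keeps it positive. *)
pose K := (M + 1) ^+ 2 * v ^+ 2.
have K0 : 0 < K by rewrite mulr_gt0 ?exprn_gt0// ltr_wpDl.
have key x : rnorm (S x) ^+ 2 <= (v ^+ 2 - K^-1) * rnorm x ^+ 2.
  set N := _ - _ in WN.
  have hN : rnorm (N x) ^+ 2 <= v ^+ 2 * (v ^+ 2 * rnorm x ^+ 2 - rnorm (S x) ^+ 2).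
    rewrite -rdotxx /N !(bopEB, bopEM, bopEZ, bopE1) !(rdotBl, rdotBr, rdotZl, rdotZr).
    rewrite (rdotC x (S (S x))) (Ssa (S x) x) !rdotxx.
    have := rnorm_opnorm S (S x); rewrite -/v => h.
    have : rnorm (S (S x)) ^+ 2 <= (v * rnorm (S x)) ^+ 2.
      by apply: lerXn2r h; rewrite nnegrE ?mulr_ge0 ?rnorm_ge0 ?ltW.
    by rewrite exprMn => *; lra.
  have hx : rnorm x <= (M + 1) * rnorm (N x).
    have -> : rnorm x = rnorm (W (N x)) by rewrite -bopEM WN.
    by apply: le_trans (WM _) _; rewrite ler_wpM2r ?rnorm_ge0// lerDl.
  have hx2 : rnorm x ^+ 2 <= (M + 1) ^+ 2 * rnorm (N x) ^+ 2.
    rewrite -exprMn; apply: lerXn2r hx;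
      by rewrite nnegrE ?mulr_ge0 ?rnorm_ge0// addr_ge0.
  have : rnorm x ^+ 2 <= K * (v ^+ 2 * rnorm x ^+ 2 - rnorm (S x) ^+ 2).
    apply: le_trans hx2 _; rewrite /K -mulrA ler_wpM2l ?sqr_ge0//.
  by rewrite mulrC -ler_pdivrMr// mulrBl [_ * K^-1]mulrC => *; lra.
(* The maximum permits a square root without deciding the sign of [v ^+ 2 - K^-1]. *)
pose k := Num.max 0 (v ^+ 2 - K^-1).
have k0 : 0 <= k by rewrite le_max lexx.
have : v <= Num.sqrt k.
  apply: opnorm_le => [|x]; first exact: sqrtr_ge0.
  rewrite -ler_sqr ?nnegrE ?mulr_ge0 ?sqrtr_ge0 ?rnorm_ge0// exprMn sqr_sqrtr//.
  by apply: le_trans (key x) _; rewrite ler_wpM2r ?sqr_ge0// le_max lexx orbT.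
rewrite -ler_sqr ?nnegrE ?sqrtr_ge0 ?(ltW v0)// sqr_sqrtr// /k le_max.
rewrite leNgt exprn_gt0//= leNgt ltrBlDr ltrDl invr_gt0 K0.
by [].
Qed.

Lemma real_spectrum_root P T : is_adjoint T T -> P != 0 ->
  ~ invertible (cev P T) -> exists2 t, real_spectrum T t & root P t%:C.
Proof.
move=> Tsa P0 nP; have [l Pl Tl] := cev_root_spectrum P0 nP.
have lE := selfadj_spectrum_real Tsa Tl.
by exists (complex.Re l); rewrite /real_spectrum /= -lE.
Qed.

(** Non-invertibility of 0 expresses that the space is nonzero. Unless [T = 0], the polynomial
    [X^2 - |T|^2] produces the point. *)
Lemma real_spectrum_nonempty T : is_adjoint T T -> ~ invertible (0 : bop H) ->
  exists t, real_spectrum T t.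
Proof.
move=> Tsa n0; have := opnorm_ge0 T; rewrite le_eqVlt => /orP[/eqP T0|Tn0].
  exists 0; rewrite /real_spectrum /spectrum /= scale0r subr0.
  by rewrite (opnorm_eq0 (esym T0)).
pose P : {poly R[i]} := 'X^2 - ((opnorm T ^+ 2)%:C)%:P.
have [||t Tt _] := @real_spectrum_root P T Tsa; last by exists t.
  by rewrite -size_poly_eq0 size_XnsubC.
rewrite /P -polyCN cevD cevC expr2 cevM cevX scaleNr.
exact: selfadj_opnorm_not_invertible.
Qed.

Lemma opoly_le T (q : {poly R}) (c : R) : is_adjoint T T -> 0 <= c ->
  (forall t, real_spectrum T t -> `|q.[t]| <= c) -> opnorm (opoly q T) <= c.
Proof.
move=> Tsa c0 qc; rewrite leNgt; apply/negP; set v := opnorm _ => cv.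
have v0 : 0 < v := le_lt_trans c0 cv.
have Ssa := opoly_selfadj q Tsa.
have nS := selfadj_opnorm_not_invertible Ssa v0.
pose P := map_poly (real_complex R) q ^+ 2 - ((v ^+ 2)%:C)%:P.
have nP : ~ invertible (cev P T).
  by rewrite /P -polyCN cevD cevC scaleNr expr2 cevM -!opolyE.
have [t Tt] : exists2 t, real_spectrum T t & root P t%:C.
  (* [P] vanishes when [q ^+ 2] is the constant [v ^+ 2]; every point of the spectrum is then a
     root, and one must be shown to exist. *)
  have [P0|P0] := eqVneq P 0; last exact: real_spectrum_root.
  have [|t Tt] := real_spectrum_nonempty Tsa.
    by move: nP; rewrite P0 /cev size_poly0 big_ord0.
  by exists t => //; rewrite P0 root0.
rewrite /root /P hornerD hornerN hornerC horner_exp horner_map -rmorphXn/=.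
rewrite subr_eq0 => /eqP/complexI/eqP.
rewrite -[_.[t] ^+ 2]real_normK ?num_real// eqrXn2 ?normr_ge0 ?ltW// => /eqP e.
by have := qc t Tt; rewrite e leNgt cv.
Qed.

End SpectralBound.

(** * Polynomial approximation of real powers on intervals *)

Section Weierstrass.
Context {R : realType}.
Implicit Types (f g : nat -> R) (t : R).

(* The Bernstein polynomial \sum_k f k 'C(n, k) X^k (1 - X)^(n - k), by
   Pascal's rule. *)
Fixpoint bernstein n f : {poly R} :=
  if n is m.+1 then 'X * bernstein m (fun k => f k.+1) + (1 - 'X) * bernstein m f
  else (f 0%N)%:P.

Lemma hornerBernsteinS n f t : (bernstein n.+1 f).[t] =
  t * (bernstein n (fun k => f k.+1)).[t] + (1 - t) * (bernstein n f).[t].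
Proof. by rewrite /= hornerD !hornerM hornerX hornerD hornerN hornerX hornerC. Qed.

Lemma bernstein_le n f g t : 0 <= t <= 1 -> (forall k, (k <= n)%N -> f k <= g k) ->
  (bernstein n f).[t] <= (bernstein n g).[t].
Proof.
move=> /andP[t0 t1]; elim: n f g => [|n IH] f g fg.
  by rewrite !hornerC fg.
rewrite !hornerBernsteinS lerD// ler_wpM2l ?subr_ge0//; apply: IH => k kn;
  apply: fg => //.
exact: leqW.
Qed.

Lemma bernsteinD n f g t :
  (bernstein n (fun k => f k + g k)).[t] = (bernstein n f).[t] + (bernstein n g).[t].
Proof.
elim: n f g => [|n IH] f g; first by rewrite !hornerC.
by rewrite !hornerBernsteinS !IH; ring.
Qed.

Lemma bernsteinZ n (c : R) f t :
  (bernstein n (fun k => c * f k)).[t] = c * (bernstein n f).[t].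
Proof.
elim: n f => [|n IH] f; first by rewrite !hornerC.
by rewrite !hornerBernsteinS !IH; ring.
Qed.

Lemma bernstein_cst n (c : R) t : (bernstein n (fun=> c)).[t] = c.
Proof.
elim: n => [|n IH]; first by rewrite !hornerC.
by rewrite !hornerBernsteinS !IH; ring.
Qed.

(** Second moment about [c] of a binomial variable: variance plus squared bias. A general [c] is
    what the induction requires, because shifting [k] replaces [c] by [c - 1]. *)
Lemma bernstein_variance n (c : R) t :
  (bernstein n (fun k => (k%:R - c) ^+ 2)).[t] =
    n%:R * t * (1 - t) + (n%:R * t - c) ^+ 2.
Proof.
elim: n c => [|n IH] c; first by rewrite !hornerC; ring.
rewrite hornerBernsteinS IH.
have -> : (bernstein n (fun k => (k.+1%:R - c) ^+ 2)).[t] =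
    (bernstein n (fun k => (k%:R - (c - 1)) ^+ 2)).[t].
  congr (_.[t]); congr (bernstein n); apply/funext => k.
  by rewrite -natr1; ring.
by rewrite IH -natr1; ring.
Qed.

Definition polynomial_limit (f : R -> R) (D : set R) : Prop :=
  forall e : R, 0 < e -> exists q : {poly R}, forall t, D t -> `|f t - q.[t]| <= e.

(** The modulus of continuity has the form [e + C (x - y)^2] because Bernstein averaging is linear
    and monotone and turns a squared distance into a variance of order [1 / n]. *)
Lemma weierstrass (f : R -> R) (M : R) : 0 < M ->
  (forall e : R, 0 < e -> exists2 C : R, 0 <= C &
     forall x y : R, 0 <= x <= M -> 0 <= y <= M ->
     `|f x - f y| <= e + C * (x - y) ^+ 2) ->
  polynomial_limit f [set t | 0 <= t <= M]%classic.
Proof.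
move=> M0 fmod e e0.
have [|C C0 fC] := fmod (e / 2); first by rewrite divr_gt0.
have M0' : M != 0 by rewrite gt_eqF.
have [n n0 nC] : exists2 n, (0 < n)%N & C * M ^+ 2 / n%:R <= e / 2.
  exists (Num.truncn (C * M ^+ 2 / (e / 2))).+1 => //.
  rewrite ler_pdivrMr ?ltr0n// [e / 2 * _]mulrC -ler_pdivrMr ?divr_gt0//.
  exact: ltW (truncnS_gt _).
have nR0 : 0 < n%:R :> R by rewrite ltr0n.
pose F k := f (k%:R / n%:R * M).
exists (bernstein n F \Po (M^-1 *: 'X)) => t /= /andP[t0 tM].
rewrite horner_comp hornerZ hornerX; set u := M^-1 * t.
have u01 : 0 <= u <= 1.
  by rewrite /u mulr_ge0 ?invr_ge0 ?(ltW M0)//= mulrC ler_pdivrMr// mul1r.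
have tE : t = u * M by rewrite /u mulrAC mulVf// mul1r.
(* The modulus between [t = u * M] and the node [k / n * M]; its Bernstein average at [u] is
   [e / 2 + C * M ^+ 2 / n * (u * (1 - u))]. *)
pose G k := e / 2 + (C * M ^+ 2 / n%:R ^+ 2) * (k%:R - n%:R * u) ^+ 2.
have GE : (bernstein n G).[u] <= e.
  rewrite /G bernsteinD bernstein_cst bernsteinZ bernstein_variance.
  rewrite subrr expr0n addr0.
  have -> : C * M ^+ 2 / n%:R ^+ 2 * (n%:R * u * (1 - u)) =
     C * M ^+ 2 / n%:R * (u * (1 - u)) by field; rewrite gt_eqF.
  have h : 0 <= C * M ^+ 2 / n%:R.
    by rewrite divr_ge0// mulr_ge0 ?sqr_ge0.
  move: h nC u01; move: (_ / n%:R) => a a0 ae /andP[u0 u1].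
  have : a * (u * (1 - u)) <= a * 1.
    by rewrite ler_wpM2l// -[leRHS]mulr1 ler_pM// ?subr_ge0// gerBl.
  by move=> *; lra.
have FG k : (k <= n)%N -> `|f t - F k| <= G k.
  move=> kn; rewrite /F /G.
  have -> : C * M ^+ 2 / n%:R ^+ 2 * (k%:R - n%:R * u) ^+ 2 =
      C * (t - k%:R / n%:R * M) ^+ 2.
    by rewrite tE; field; rewrite gt_eqF.
  apply: fC; first by rewrite t0.
  rewrite mulr_ge0 ?divr_ge0 ?(ltW M0)//= ler_piMl ?(ltW M0)//.
  by rewrite ler_pdivrMr// mul1r ler_nat.
have diffE : f t - (bernstein n F).[u] = (bernstein n (fun k => f t + -1 * F k)).[u].
  by rewrite bernsteinD bernstein_cst bernsteinZ mulN1r.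
rewrite diffE ler_norml; apply/andP; split.
  apply: (@le_trans _ _ (bernstein n (fun k => -1 * G k)).[u]).
    by rewrite bernsteinZ mulN1r lerN2.
  apply: bernstein_le => // k kn.
  by have := FG k kn; rewrite !mulN1r ler_norml => /andP[].
apply: le_trans GE; apply: bernstein_le => // k kn.
by have := FG k kn; rewrite mulN1r ler_norml => /andP[].
Qed.

Lemma polynomial_limit_sub (f g : R -> R) (D E : set R) :
  polynomial_limit f E -> (forall t, D t -> E t /\ g t = f t) -> polynomial_limit g D.
Proof.
move=> fE DE e e0; have [q qP] := fE e e0; exists q => t /DE[Et ->]; exact: qP.
Qed.

Lemma polynomial_limit_sqrt (M : R) : 0 < M ->
  polynomial_limit (fun t => t `^ 2^-1) [set t | 0 <= t <= M]%classic.
Proof.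
move=> M0.
apply: (@polynomial_limit_sub Num.sqrt _ _ [set t | 0 <= t <= M]%classic); last first.
  by move=> t /= /andP[t0 tM]; rewrite t0 tM powR12_sqrt.
(* The difference [d] of the roots satisfies [d^2 <= |x - y|]. If [d > e], then
   [d e^3 <= d^4 <= (x - y)^2]. *)
apply: weierstrass => // e e0; exists (e ^+ 3)^-1 => [|x y /andP[x0 _] /andP[y0 _]].
  by rewrite invr_ge0 exprn_ge0 ?ltW.
wlog xy : x y x0 y0 / y <= x.
  move=> hw; have [yx|xy] := leP y x; first exact: hw.
  by rewrite distrC -[(x - y) ^+ 2]sqrrN opprB; apply: hw => //; exact: ltW.
have s0 : 0 <= Num.sqrt x - Num.sqrt y by rewrite subr_ge0 ler_sqrt.
rewrite ger0_norm//.
set d := _ - _ in s0 *.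
have dxy : d ^+ 2 <= x - y.
  rewrite /d -{2}(sqr_sqrtr x0) -{2}(sqr_sqrtr y0).
  have := sqrtr_ge0 y; move: s0; rewrite /d.
  move: (Num.sqrt x) (Num.sqrt y) => a b h1 h2; nra.
have [de|ed] := leP d e.
  by rewrite (le_trans de)// lerDl mulr_ge0 ?invr_ge0 ?sqr_ge0 ?exprn_ge0// ltW.
apply: (@le_trans _ _ ((e ^+ 3)^-1 * (x - y) ^+ 2)); last by rewrite lerDr ltW.
rewrite mulrC ler_pdivlMr ?exprn_gt0//.
apply: (@le_trans _ _ ((d ^+ 2) ^+ 2)); last first.
  by apply: lerXn2r dxy; rewrite nnegrE ?sqr_ge0// subr_ge0.
rewrite -exprM (exprS d 3) ler_wpM2l//.
by apply: lerXn2r (ltW ed); rewrite nnegrE// ltW.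
Qed.

Lemma polynomial_limit_powR (m M a : R) : 0 < m -> m <= M ->
  polynomial_limit (fun t => t `^ a) [set t | m <= t <= M]%classic.
Proof.
move=> m0 mM; have M0 : 0 < M := lt_le_trans m0 mM.
(* Freezing the power below [m] extends it to a Lipschitz function on all of [[0, M]], the kind of
   interval that [weierstrass] handles. *)
pose f t := expR (a * ln (Num.max m t)).
apply: (@polynomial_limit_sub f _ _ [set t | 0 <= t <= M]%classic); last first.
  move=> t /= /andP[mt tM]; rewrite tM (le_trans (ltW m0) mt); split => //.
  by rewrite /f max_r// /powR gt_eqF// (lt_le_trans m0).
pose B := expR (`|a| * (`|ln m| + `|ln M|)).
pose L := B * (`|a| / m).
have B0 : 0 < B := expR_gt0 _.
have L0 : 0 <= L by rewrite !mulr_ge0 ?invr_ge0// ltW.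
have ln_lip x y : m <= x -> m <= y -> ln x - ln y <= `|x - y| / m.
  move=> mx my; have x0 := lt_le_trans m0 mx; have y0 := lt_le_trans m0 my.
  rewrite -ln_div ?posrE//.
  have -> : x / y = 1 + (x - y) / y by field; rewrite gt_eqF.
  apply: le_trans (le_ln1Dx _) _.
    by rewrite ltr_pdivlMr//; lra.
  apply: le_trans (ler_norm _) _; rewrite normrM ler_wpM2l//.
  by rewrite gtr0_norm ?invr_gt0// lef_pV2.
have f_le x y : 0 <= x <= M -> 0 <= y <= M -> f x - f y <= L * `|x - y|.
  move=> /andP[x0 xM] /andP[y0 yM]; rewrite /f.
  set x' := Num.max m x; set y' := Num.max m y.
  have mx : m <= x' by rewrite le_max lexx.
  have my : m <= y' by rewrite le_max lexx.
  have x'M : x' <= M by rewrite ge_max mM.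
  have x'0 := lt_le_trans m0 mx.
  have xy' : `|x' - y'| <= `|x - y|.
    rewrite /x' /y'; case: (leP m x) => h1; case: (leP m y) => h2 //.
    - rewrite !ger0_norm; lra.
    - rewrite distrC [leRHS]distrC !ger0_norm; lra.
    - by rewrite subrr normr0.
  have fB : expR (a * ln x') <= B.
    rewrite ler_expR; apply: le_trans (ler_norm _) _; rewrite normrM ler_wpM2l//.
    have lm : ln m <= ln x' by rewrite ler_ln ?posrE.
    have lM : ln x' <= ln M by rewrite ler_ln ?posrE.
    rewrite ler_norml; apply/andP; split.
      by have := ler_norm (- ln m); rewrite normrN; have := normr_ge0 (ln M) => *; lra.
    by have := ler_norm (ln M); have := normr_ge0 (ln m) => *; lra.
  have lxy : `|ln x' - ln y'| <= `|x' - y'| / m.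
    by rewrite ler_norml lerNl opprB ln_lip// distrC ln_lip.
  (* Convexity of the exponential: [exp u - exp v <= exp u * (u - v)]. *)
  apply: (@le_trans _ _ (expR (a * ln x') * (a * (ln x' - ln y')))).
    have := expR_ge1Dx (a * ln y' - a * ln x').
    rewrite expRD expRN; have := expR_gt0 (a * ln x').
    move: (expR (a * ln x')) (expR (a * ln y')) => p q p0 h.
    have : p * (1 + (a * ln y' - a * ln x')) <= p * (q / p) by rewrite ler_pM2l.
    by rewrite [p * (q / p)]mulrC divfK ?gt_eqF// => *; lra.
  apply: le_trans (ler_norm _) _; rewrite !normrM gtr0_norm ?expR_gt0// /L -!mulrA.
  rewrite ler_pM ?expR_ge0 ?mulr_ge0// ler_wpM2l//; apply: le_trans lxy _.
  by rewrite mulrC ler_wpM2l// invr_ge0 ltW.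
(* By the arithmetic-geometric mean inequality, [L d <= e + L^2 d^2 / (4 e)]. *)
apply: weierstrass => // e e0; exists (L ^+ 2 / (4 * e)) => [|x y x01 y01].
  by rewrite divr_ge0 ?sqr_ge0 ?mulr_ge0 ?ltW.
have : `|f x - f y| <= L * `|x - y|.
  by rewrite ler_norml lerNl opprB f_le// distrC f_le.
move=> /le_trans; apply.
have -> : (x - y) ^+ 2 = `|x - y| ^+ 2 by rewrite real_normK ?num_real.
move: (`|x - y|) => d.
have : 0 <= (e - L * d / 2) ^+ 2 / e by rewrite divr_ge0 ?sqr_ge0 ?ltW.
have -> : (e - L * d / 2) ^+ 2 / e = e + L ^+ 2 / (4 * e) * d ^+ 2 - L * d.
  by field; rewrite gt_eqF.
by rewrite subr_ge0.
Qed.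

End Weierstrass.

(** * Continuous functional calculus of a self-adjoint operator *)

Section ContinuousCalculus.
Context {R : realType} {H : hilbertType R}.
Implicit Types (x y z : H) (S T U V : bop H) (f g : R -> R) (q : {poly R}).

Lemma opnormN T : opnorm (- T) = opnorm T.
Proof.
apply/eqP; rewrite eq_le; apply/andP; split; apply: opnorm_le (opnorm_ge0 _) _ => x.
  by rewrite bopEN rnormN rnorm_opnorm.
by rewrite -rnormN -bopEN rnorm_opnorm.
Qed.

Lemma opnormD S T : opnorm (S + T) <= opnorm S + opnorm T.
Proof.
apply: opnorm_le => [|x]; first by rewrite addr_ge0 ?opnorm_ge0.
by rewrite bopED mulrDl; apply: le_trans (rnormD _ _) _; rewrite lerD ?rnorm_opnorm.
Qed.

Lemma opnormM S T : opnorm (S * T) <= opnorm S * opnorm T.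
Proof.
apply: opnorm_le => [|x]; first by rewrite mulr_ge0 ?opnorm_ge0.
rewrite bopEM -mulrA; apply: le_trans (rnorm_opnorm _ _) _.
by rewrite ler_wpM2l ?opnorm_ge0 ?rnorm_opnorm.
Qed.

Lemma opnorm_small_eq S T : (forall e, 0 < e -> opnorm (S - T) <= e) -> S = T.
Proof.
move=> ST; apply/eqP; rewrite -subr_eq0; apply/eqP/opnorm_eq0/eqP.
rewrite eq_le opnorm_ge0 andbT; apply/ler_addgt0Pr => e /ST.
by rewrite add0r.
Qed.

(** Both convergences are merged into a single tolerance met by a single polynomial; conversely,
    tolerances [1 / (n + 1)] rebuild the sequence. *)
Lemma is_cfcP f T S : is_cfc f T S <-> forall e : R, 0 < e -> exists q,
  (forall t, real_spectrum T t -> `|f t - q.[t]| <= e) /\ opnorm (opoly q T - S) <= e.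
Proof.
split=> [[q [qf qS]] e e0|h].
  have [N1 _ h1] : (\forall n \near \oo,
      forall t, real_spectrum T t -> `|f t - (q n).[t]| < e)%classic.
    have := qf [set g | forall t, real_spectrum T t -> `|f t - g t| < e]%classic.
    apply; apply/uniform_nbhs.
    exists [set xy : R * R | `|xy.1 - xy.2| < e]%classic; split.
      by rewrite -entourage_ballE; exists e.
    by move=> g /= gP t Tt; exact: gP.
  have /cvgrPdist_lt/(_ _ e0)[N2 _ h2] := qS.
  exists (q (maxn N1 N2)); split=> [t Tt|].
    by rewrite ltW// h1 //= leq_maxl.
  by have := h2 _ (leq_maxr N1 N2); rewrite sub0r normrN ger0_norm
    ?opnorm_ge0// => /ltW.
have invS0 n : 0 < n.+1%:R^-1 :> R by rewrite invr_gt0 ltr0n.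
have [q qP] := boolp.choice (fun n => h _ (invS0 n)).
exists q; split.
  move=> /= A /uniform_nbhs[E [+ EA]]; rewrite -entourage_ballE => -[e /= e0 eE].
  have [N NP] := ltr_invS e0; exists N => // n /= Nn.
  apply: EA => t Tt; apply: eE; rewrite /ball/=.
  by have [+ _] := qP n; move=> /(_ t Tt)/le_lt_trans; apply; exact: NP.
apply/cvgrPdist_lt => e e0; have [N NP] := ltr_invS e0; exists N => // n /= Nn.
rewrite sub0r normrN ger0_norm ?opnorm_ge0//.
by have [_] := qP n; move=> /le_lt_trans; apply; exact: NP.
Qed.

(** Half of the spectral mapping theorem. Were [|q(t)| > |q(T)|], then [q(T) - q(t)] would be
    bounded below, hence invertible; its factor [T - t] commutes with the cofactor, so it would be
    invertible too. *)
Lemma real_spectrum_opoly_le T q t : is_adjoint T T -> real_spectrum T t ->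
  `|q.[t]| <= opnorm (opoly q T).
Proof.
move=> Tsa Tt; rewrite leNgt; apply/negP => qt; apply: Tt.
set S := opoly q T in qt.
have SI : invertible (S - (q.[t])%:C *: (1 : bop H)).
  have c0 : 0 < `|q.[t]| - opnorm S by rewrite subr_gt0.
  apply: (selfadj_bounded_below_invertible _ c0).
    exact: selfadj_shift (opoly_selfadj q Tsa).
  move=> x; rewrite bopEB bopEZ bopE1 mulrBl -rnormZr.
  have := rnormD (S x) ((q.[t])%:C *: x - S x); rewrite addrC subrK rnormB.
  by have := rnorm_opnorm S x => *; lra.
have [r rE] : exists r, q - (q.[t])%:P = r * ('X - t%:P).
  by apply/factor_theorem; rewrite /root hornerD hornerN hornerC subrr.
have TE : T - t%:C *: (1 : bop H) = opoly ('X - t%:P) T.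
  by rewrite opolyB opolyX opolyC.
rewrite TE; apply: (@invertible_commM _ _ _ (opoly r T)).
  by rewrite -!opolyM mulrC.
by rewrite -opolyM mulrC -rE opolyB opolyC.
Qed.

Lemma is_cfc_spectrum_le f T S t : is_adjoint T T -> is_cfc f T S ->
  real_spectrum T t -> `|f t| <= opnorm S.
Proof.
move=> Tsa /is_cfcP fS Tt; apply/ler_addgt0Pr => e e0.
have [|q [fq qS]] := fS (e / 2); first by rewrite divr_gt0.
have h1 := ler_normD (f t - q.[t]) q.[t]; rewrite subrK in h1.
have h2 := opnormD (opoly q T - S) S; rewrite subrK in h2.
by have := real_spectrum_opoly_le q Tsa Tt; have := fq t Tt => *; lra.
Qed.

(** Agreement is asked on the spectrum only, so identities between powers of positive reals turn
    into identities between operators. Approximants of [f] and [g] are uniformly close there, and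
    [opoly_le] makes them close in norm. *)
Lemma is_cfc_uniq f g T S U : is_adjoint T T -> is_cfc f T S -> is_cfc g T U ->
  (forall t, real_spectrum T t -> f t = g t) -> S = U.
Proof.
move=> Tsa /is_cfcP fS /is_cfcP gU fg; apply: opnorm_small_eq => e e0.
have e40 : 0 < e / 4 by rewrite divr_gt0.
have [q [fq qS]] := fS _ e40; have [p [gp pU]] := gU _ e40.
have h : opnorm (opoly (p - q) T) <= e / 4 + e / 4.
  apply: opoly_le => // [|t Tt]; first by rewrite addr_ge0 ?ltW.
  rewrite hornerD hornerN.
  have -> : p.[t] - q.[t] = (f t - q.[t]) - (g t - p.[t]) by rewrite fg//; ring.
  by apply: le_trans (ler_normB _ _) _; rewrite lerD ?fq ?gp.
have -> : S - U = - opoly (p - q) T + ((opoly p T - U) - (opoly q T - S)).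
  by rewrite opolyB !opprB addrA subrKA addrC subrKA.
apply: le_trans (opnormD _ _) _; rewrite opnormN.
have := opnormD (opoly p T - U) (- (opoly q T - S)); rewrite opnormN => *; lra.
Qed.

Lemma is_cfcM f g T S U : is_adjoint T T -> is_cfc f T S -> is_cfc g T U ->
  is_cfc (fun t => f t * g t) T (S * U).
Proof.
move=> Tsa fS gU; apply/is_cfcP => e e0.
pose K := opnorm S + opnorm U + 1.
have S0 := opnorm_ge0 S; have U0 := opnorm_ge0 U.
have K0 : 0 < K by rewrite /K; lra.
(* As [d <= 1], the errors [d |S|], [d |U|] and [d^2] add up to at most [d * K]. *)
pose d := Num.min 1 (e / K).
have d0 : 0 < d by rewrite lt_min ltr01 divr_gt0.
have d1 : d <= 1 by rewrite ge_min lexx.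
have dK : d * K <= e by rewrite -ler_pdivlMr// ge_min lexx orbT.
have [q [fq qS]] := (is_cfcP _ _ _).1 fS d d0.
have [p [gp pU]] := (is_cfcP _ _ _).1 gU d d0.
exists (q * p); split=> [t Tt|].
  have ft := is_cfc_spectrum_le Tsa fS Tt; have gt := is_cfc_spectrum_le Tsa gU Tt.
  rewrite hornerM.
  have -> : f t * g t - q.[t] * p.[t] =
      f t * (g t - p.[t]) + (f t - q.[t]) * g t - (f t - q.[t]) * (g t - p.[t]).
    by ring.
  apply: le_trans (ler_normB _ _) _; rewrite !normrM.
  have h0 := ler_normD (f t * (g t - p.[t])) ((f t - q.[t]) * g t).
  rewrite !normrM in h0.
  have h1 := ler_pM (normr_ge0 _) (normr_ge0 _) ft (gp t Tt).
  have h2 := ler_pM (normr_ge0 _) (normr_ge0 _) (fq t Tt) gt.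
  have h3 := ler_pM (normr_ge0 _) (normr_ge0 _) (fq t Tt) (gp t Tt).
  have h4 : d * d <= d by rewrite ler_piMr// ltW.
  by move: dK; rewrite /K => *; lra.
have -> : opoly (q * p) T - S * U =
    S * (opoly p T - U) + (opoly q T - S) * U + (opoly q T - S) * (opoly p T - U).
  by rewrite opolyM -addrA -mulrDr [U + _]addrC subrK mulrBr mulrBl addrC subrKA.
apply: le_trans (opnormD _ _) _.
have h0 := opnormD (S * (opoly p T - U)) ((opoly q T - S) * U).
have h1 := le_trans (opnormM S (opoly p T - U)) (ler_pM S0 (opnorm_ge0 _) (lexx _) pU).
have h2 := le_trans (opnormM (opoly q T - S) U) (ler_pM (opnorm_ge0 _) U0 qS (lexx _)).
have h3 := le_trans (opnormM (opoly q T - S) (opoly p T - U))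
  (ler_pM (opnorm_ge0 _) (opnorm_ge0 _) qS pU).
have h4 : d * d <= d by rewrite ler_piMr// ltW.
by move: dK; rewrite /K => *; lra.
Qed.

Lemma is_cfc_opoly q f T : (forall t, q.[t] = f t) -> is_cfc f T (opoly q T).
Proof.
move=> qf; apply/is_cfcP => e e0; exists q.
split=> [t _|]; first by rewrite qf subrr normr0 ltW.
rewrite subrr; apply: opnorm_le (ltW e0) _ => x.
by rewrite bopE0 rnorm0 mulr_ge0 ?rnorm_ge0 ?ltW.
Qed.

Lemma is_cfc_id T : is_cfc id T T.
Proof. by have := is_cfc_opoly T (@hornerX R); rewrite opolyX. Qed.

Lemma is_cfc_1 T : is_cfc (fun=> 1) T 1.
Proof. by have := is_cfc_opoly T (hornerC 1); rewrite opolyC scale1r. Qed.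

Lemma is_cfc_selfadj f T S : is_adjoint T T -> is_cfc f T S -> is_adjoint S S.
Proof.
move=> Tsa /is_cfcP fS; apply/is_adjointP => x y; apply/eqP.
rewrite -subr_eq0 -normr_eq0 eq_le normr_ge0 andbT.
apply/ler_addgt0Pr => e e0; rewrite add0r.
pose C := 2 * rnorm x * rnorm y + 1.
have C0 : 0 < C by rewrite ltr_wpDl ?mulr_ge0 ?rnorm_ge0.
have [|q [_ qS]] := fS (e / C); first by rewrite divr_gt0.
have qsa := (is_adjointP _ _).1 (opoly_selfadj q Tsa).
(* [opoly q T] is self-adjoint, so only its small distance to [S] contributes. *)
have -> : rdot (S x) y - rdot x (S y) =
    rdot x ((opoly q T - S) y) - rdot ((opoly q T - S) x) y.
  by rewrite !bopEB rdotBl rdotBr qsa; ring.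
have hq z : rnorm ((opoly q T - S) z) <= e / C * rnorm z.
  by apply: le_trans (rnorm_opnorm _ _) _; rewrite ler_wpM2r ?rnorm_ge0.
apply: le_trans (ler_normB _ _) _.
have h1 := le_trans (rdot_norm_le x ((opoly q T - S) y))
  (ler_pM (rnorm_ge0 _) (rnorm_ge0 _) (lexx _) (hq y)).
have h2 := le_trans (rdot_norm_le ((opoly q T - S) x) y)
  (ler_pM (rnorm_ge0 _) (rnorm_ge0 _) (hq x) (lexx _)).
have eC : e / C * C = e by rewrite divfK ?gt_eqF.
have : 0 < e / C by rewrite divr_gt0.
move: eC; rewrite {2}/C; move: h1 h2.
move: (e / C) (rnorm x) (rnorm y) => d u v h1 h2 h3 h4.
by apply: le_trans (lerD h1 h2) _; lra.
Qed.

(* With f <= K on the spectrum, ||K - S|| <= K, so 2 K <S x, x> >= ||S x||^2. *)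
Lemma is_cfc_ge0 f T S : is_adjoint T T -> is_cfc f T S ->
  (forall t, real_spectrum T t -> 0 <= f t) -> forall x, 0 <= rdot (S x) x.
Proof.
move=> Tsa fS f0 x.
pose K := opnorm S + 1.
have K0 : 0 < K by rewrite ltr_wpDl ?opnorm_ge0.
have fK t : real_spectrum T t -> f t <= K.
  move=> /(is_cfc_spectrum_le Tsa fS) h; have := ler_norm (f t); rewrite /K; lra.
have : opnorm (K%:C *: (1 : bop H) - S) <= K.
  apply/ler_addgt0Pr => e e0.
  have e20 : 0 < e / 2 by rewrite divr_gt0.
  have [q [fq qS]] := (is_cfcP _ _ _).1 fS _ e20.
  have h : opnorm (opoly (K%:P - q) T) <= K + e / 2.
    apply: opoly_le => // [|t Tt]; first by rewrite addr_ge0 ?ltW.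
    rewrite hornerD hornerN hornerC.
    have := fq t Tt; have := fK t Tt; have := f0 t Tt.
    by rewrite !ler_norml => h1 h2 /andP[h3 h4]; apply/andP; split; lra.
  have -> : K%:C *: (1 : bop H) - S = opoly (K%:P - q) T + (opoly q T - S).
    by rewrite opolyB opolyC addrA subrK.
  by apply: le_trans (opnormD _ _) _; lra.
move=> h; have := le_trans (rnorm_opnorm _ x) (ler_wpM2r (rnorm_ge0 x) h).
rewrite bopEB bopEZ bopE1 => hx.
have : rnorm (K%:C *: x - S x) ^+ 2 <= (K * rnorm x) ^+ 2.
  by apply: lerXn2r hx; rewrite nnegrE ?mulr_ge0 ?rnorm_ge0 ?ltW.
rewrite -rdotxx !(rdotBl, rdotBr, rdotZl, rdotZr) !rdotxx (rdotC x) => h1.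
have := sqr_ge0 (rnorm (S x)) => h2.
by rewrite -(pmulr_rge0 _ K0); lra.
Qed.

(** By [opoly_le] the approximants are Cauchy in norm. Their pointwise limit is taken with the rate
    [e n * |x|]; this rate yields linearity, boundedness and norm convergence of the limit. *)
Lemma is_cfc_exists f T : is_adjoint T T -> polynomial_limit f (real_spectrum T) ->
  exists S, is_cfc f T S.
Proof.
move=> Tsa fT; pose e n : R := n.+1%:R^-1.
have e0 n : 0 < e n by rewrite invr_gt0 ltr0n.
have [q qP] := boolp.choice (fun n : nat => fT (e n) (e0 n)).
have qC m n : opnorm (opoly (q m) T - opoly (q n) T) <= e m + e n.
  rewrite -opolyB; apply: opoly_le => // [|t Tt]; first by rewrite addr_ge0 ?ltW.
  rewrite hornerD hornerN.
  have -> : (q m).[t] - (q n).[t] = (f t - (q n).[t]) - (f t - (q m).[t]) by ring.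
  by apply: le_trans (ler_normB _ _) _; rewrite addrC lerD ?qP.
have qCx m n x : rnorm (opoly (q m) T x - opoly (q n) T x) <= (e m + e n) * rnorm x.
  by rewrite -bopEB; apply: le_trans (rnorm_opnorm _ _) _; rewrite ler_wpM2r ?rnorm_ge0.
have ex x : exists l, forall n, rnorm (l - opoly (q n) T x) <= e n * rnorm x.
  have hx1 : 0 < rnorm x + 1 by rewrite ltr_wpDl ?rnorm_ge0.
  have [|l lP] := @rnorm_complete _ _ (fun n => opoly (q n) T x).
    move=> d d0; have [|N NP] := @ltr_invS R (d / 2 / (rnorm x + 1)).
      by rewrite !divr_gt0.
    exists N => m n Nm Nn; apply: le_lt_trans (qCx m n x) _.
    have := NP m Nm; have := NP n Nn; rewrite -/(e m) -/(e n) !ltr_pdivlMr//.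
    have := rnorm_ge0 x; have := e0 m; have := e0 n => *; lra.
  exists l => n; apply/ler_addgt0Pr => d d0.
  have d20 : 0 < d / 2 by rewrite divr_gt0.
  have [N1 N1P] := lP _ d20.
  have [|N2 N2P] := @ltr_invS R (d / 2 / (rnorm x + 1)); first by rewrite !divr_gt0.
  pose m := maxn N1 N2.
  have h1 := N1P m (leq_maxl _ _); have h2 := N2P m (leq_maxr _ _).
  have h3 := rnormD (l - opoly (q m) T x) (opoly (q m) T x - opoly (q n) T x).
  rewrite addrA subrK in h3; rewrite rnormB in h1.
  rewrite -/(e m) ltr_pdivlMr// in h2.
  by have := qCx m n x; have := e0 m => *; lra.
have [g gP] := boolp.choice ex.
have glin : linear g.
  move=> c x y; apply/eqP; rewrite -subr_eq0 -rnorm_eq0 eq_le rnorm_ge0 andbT.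
  pose C := rnorm (c *: x + y) + complex.Re `|c| * rnorm x + rnorm y + 1.
  have C0 : 0 < C.
    rewrite ltr_wpDl// !addr_ge0 ?rnorm_ge0// mulr_ge0 ?rnorm_ge0//.
    by rewrite -ler0c RRe_real ?normr_real.
  apply/ler_addgt0Pr => d d0; rewrite add0r.
  have [|N NP] := @ltr_invS R (d / C); first by rewrite divr_gt0.
  have := NP N (leqnn _); rewrite -/(e N) ltr_pdivlMr// => /ltW; apply: le_trans.
  set P := opoly (q N) T.
  have -> : g (c *: x + y) - (c *: g x + g y) =
      (g (c *: x + y) - P (c *: x + y)) - (c *: (g x - P x) + (g y - P y)).
    by rewrite bopD bopZ scalerBr addrACA -opprD opprB subrKA.
  apply: le_trans (rnormD _ _) _; rewrite rnormN.
  have h1 := gP (c *: x + y) N; have h2 := rnormD (c *: (g x - P x)) (g y - P y).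
  have h3 := gP y N; rewrite rnormZ in h2.
  have h4 : complex.Re `|c| * rnorm (g x - P x) <= complex.Re `|c| * (e N * rnorm x).
    by rewrite ler_wpM2l ?gP// -ler0c RRe_real ?normr_real.
  by rewrite -/P in h1 h3; have := e0 N; rewrite /C => *; lra.
have [|S SE] := bop_of_linear (M := opnorm (opoly (q 0%N) T) + e 0%N) glin.
  move=> x; rewrite mulrDl.
  have := rnormD (opoly (q 0%N) T x) (g x - opoly (q 0%N) T x).
  rewrite addrC subrK; have := gP x 0%N.
  have := rnorm_opnorm (opoly (q 0%N) T) x => *; lra.
exists S; apply/is_cfcP => d d0; have [N NP] := ltr_invS d0; exists (q N).
have eNd : e N <= d by rewrite ltW// NP.
split=> [t Tt|]; first by apply: le_trans eNd; exact: qP.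
apply: le_trans eNd; apply: opnorm_le => [|x]; first exact: ltW.
by rewrite bopEB SE rnormB.
Qed.

Lemma cfcP f T : is_adjoint T T -> polynomial_limit f (real_spectrum T) ->
  is_cfc f T (cfc f T).
Proof. by move=> Tsa fT; apply: xgetPex; exact: is_cfc_exists. Qed.

End ContinuousCalculus.

(** * Real powers, absolute values, and the algebra of the inequality *)

Section Powers.
Context {R : realType} {H : hilbertType R}.
Implicit Types (x y z : H) (S T U V C X : bop H).

Definition psd T := is_adjoint T T /\ forall x, 0 <= rdot (T x) x.

Lemma psd_spectrum T t : psd T -> real_spectrum T t -> 0 <= t <= opnorm T.
Proof.
move=> [Tsa T0] Tt; have := real_spectrum_opoly_le 'X Tsa Tt.
rewrite hornerX opolyX => /ler_normlW ->; rewrite andbT leNgt; apply/negP => t0.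
(* For [t < 0], positivity of [T] makes [T - t] coercive with constant [- t]. *)
apply: Tt; apply: (@coercive_invertible _ _ _ (- t)).
- exact: selfadj_shift.
- by rewrite oppr_gt0.
by move=> x; rewrite bopEB bopEZ bopE1 rdotBl rdotZl rdotxx mulNr lerDr.
Qed.

Lemma psd_invertible_spectrum T : psd T -> invertible T ->
  exists m M : R, [/\ 0 < m, m <= M & forall t, real_spectrum T t -> m <= t <= M].
Proof.
move=> Tpsd [V [VT _]]; have [Tsa T0] := Tpsd.
have [K K0 VK] := bop_rnorm_bounded V.
have K10 : 0 < K + 1 by rewrite ltr_wpDl.
have m0 : 0 < (K + 1)^-1 by rewrite invr_gt0.
(* With [|x| <= (K + 1) |T x|], the operator [T - t] is bounded below for [0 <= t < (K + 1)^-1].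
   Adding this number to the norm ensures [m <= M] even when the spectrum is empty. *)
exists (K + 1)^-1, (opnorm T + (K + 1)^-1); split => //.
  by rewrite lerDr opnorm_ge0.
move=> t Tt; have /andP[t0 tT] := psd_spectrum Tpsd Tt.
rewrite (ler_wpDr (ltW m0) tT) andbT leNgt; apply/negP => tm.
apply: Tt; have c0 : 0 < (K + 1)^-1 - t by rewrite subr_gt0.
apply: (selfadj_bounded_below_invertible _ c0); first exact: selfadj_shift.
move=> x; rewrite bopEB bopEZ bopE1 mulrBl.
have xE : rnorm x <= (K + 1) * rnorm (T x).
  rewrite -[X in rnorm X <= _](bopE1 x) -VT bopEM; apply: le_trans (VK _) _.
  by rewrite ler_wpM2r ?rnorm_ge0// lerDl.
have h1 : (K + 1)^-1 * rnorm x <= rnorm (T x) by rewrite mulrC ler_pdivrMr// mulrC.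
have := rnormD (T x - t%:C *: x) (t%:C *: x); rewrite subrK rnormZr ger0_norm// => h2.
by lra.
Qed.

Lemma is_cfc_opow T (a : R) : psd T -> invertible T ->
  is_cfc (fun t => t `^ a) T (opow T a).
Proof.
move=> Tpsd Tinv; have [Tsa _] := Tpsd.
have [m [M [m0 mM mMT]]] := psd_invertible_spectrum Tpsd Tinv.
apply: cfcP => //.
apply: polynomial_limit_sub (polynomial_limit_powR a m0 mM) _ => t Tt.
by split=> //=; exact: mMT.
Qed.

Lemma opow_selfadj T (a : R) : psd T -> invertible T ->
  is_adjoint (opow T a) (opow T a).
Proof.
move=> Tpsd Tinv; apply: is_cfc_selfadj (is_cfc_opow a _ _) => //.
by case: Tpsd.
Qed.

Lemma opowM T (a b : R) : psd T -> invertible T ->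
  opow T a * opow T b = opow T (a + b).
Proof.
move=> Tpsd Tinv; have [Tsa _] := Tpsd.
have [m [M [m0 mM mMT]]] := psd_invertible_spectrum Tpsd Tinv.
apply: (is_cfc_uniq Tsa (is_cfcM Tsa (is_cfc_opow a _ _) (is_cfc_opow b _ _))
  (is_cfc_opow (a + b) _ _)) => // t /mMT/andP[mt _] /=.
by rewrite powRD// (gt_eqF (lt_le_trans m0 mt)) implybT.
Qed.

Lemma opow0 T : psd T -> invertible T -> opow T 0 = 1.
Proof.
move=> Tpsd Tinv; have [Tsa _] := Tpsd.
by apply: (is_cfc_uniq Tsa (is_cfc_opow 0 _ _) (is_cfc_1 T)) => // t _; rewrite powRr0.
Qed.

Lemma opow1 T : psd T -> invertible T -> opow T 1 = T.
Proof.
move=> Tpsd Tinv; have [Tsa _] := Tpsd.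
apply: (is_cfc_uniq Tsa (is_cfc_opow 1 _ _) (is_cfc_id T)) => // t Tt.
by rewrite powRr1//; case/andP: (psd_spectrum Tpsd Tt).
Qed.

Lemma psd_adjointM C : psd (adjoint C * C).
Proof.
have Csa := adjointP C; split=> [|x]; first exact: is_adjointM (is_adjoint_sym Csa) Csa.
by rewrite bopEM ((is_adjointP _ _).1 (is_adjoint_sym Csa)) rdotxx sqr_ge0.
Qed.

Lemma is_cfc_oabs C : is_cfc (fun t => t `^ 2^-1) (adjoint C * C) (oabs C).
Proof.
have Cpsd := psd_adjointM C; have [Csa _] := Cpsd.
(* Adding 1 keeps the interval nondegenerate when [C = 0]. *)
have M0 : 0 < opnorm (adjoint C * C) + 1 by rewrite ltr_wpDl ?opnorm_ge0.
apply: cfcP => //; apply: polynomial_limit_sub (polynomial_limit_sqrt M0) _ => t Tt.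
have /andP[t0 tC] := psd_spectrum Cpsd Tt.
by split=> //=; rewrite t0 (ler_wpDr _ tC).
Qed.

Lemma psd_oabs C : psd (oabs C).
Proof.
have [Csa _] := psd_adjointM C.
split; first exact: is_cfc_selfadj (is_cfc_oabs C).
by apply: (is_cfc_ge0 Csa (is_cfc_oabs C)) => t _; exact: powR_ge0.
Qed.

Lemma oabs_sqr C : oabs C ^+ 2 = adjoint C * C.
Proof.
have Cpsd := psd_adjointM C; have [Csa _] := Cpsd.
apply: (is_cfc_uniq Csa (is_cfcM Csa (is_cfc_oabs C) (is_cfc_oabs C)) (is_cfc_id _)).
move=> t Tt; have /andP[t0 _] := psd_spectrum Cpsd Tt.
have e : 2^-1 + 2^-1 = 1 :> R by field.
by rewrite -powRD e ?powRr1// oner_eq0.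
Qed.

Lemma adjointE S T : is_adjoint S T -> adjoint S = T.
Proof. by move=> ST; apply: (is_adjoint_uniq (adjointP S)). Qed.

Lemma adjointM S T : adjoint (S * T) = adjoint T * adjoint S.
Proof. by apply: adjointE; apply: is_adjointM; exact: adjointP. Qed.

Lemma adjointD S T : adjoint (S + T) = adjoint S + adjoint T.
Proof. by apply: adjointE; apply: is_adjointD; exact: adjointP. Qed.

Lemma adjointZr (a : R) T : adjoint (a%:C *: T) = a%:C *: adjoint T.
Proof.
by apply: adjointE; have := is_adjointZ a%:C (adjointP T); rewrite conjc_real.
Qed.

Lemma adjointN T : adjoint (- T) = - adjoint T.
Proof.
apply: adjointE; have := is_adjointZ (-1) (adjointP T).
by rewrite rmorphN rmorph1 !scaleN1r.
Qed.

Lemma adjointM_eq0 T : adjoint T * T = 0 -> T = 0.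
Proof.
move=> T0; apply: bopP => x; apply/eqP; rewrite bopE0 -rnorm_eq0 -sqrf_eq0 -rdotxx.
by rewrite ((is_adjointP _ _).1 (adjointP T)) -bopEM T0 rdotC rdot0l.
Qed.

Lemma positive_adjointM (c : R) T : 0 <= c -> positive_op (c%:C *: (adjoint T * T)).
Proof.
move=> c0 x; rewrite bopEZ hdotZl bopEM (is_adjoint_sym (adjointP T)) hdot_norm.
by rewrite mulr_ge0 ?ler0c// exprn_ge0.
Qed.

(* The weighted parallelogram identity behind |P + Q|^2 <= r |P|^2 + s |Q|^2. *)
Lemma conjugate_exponent_identity (r s : R) (P Q : bop H) : 1 < r -> r^-1 + s^-1 = 1 ->
  r%:C *: (adjoint P * P) + s%:C *: (adjoint Q * Q) - adjoint (P + Q) * (P + Q) =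
  ((r - 1)^-1)%:C *: (adjoint ((r - 1)%:C *: P - Q) * ((r - 1)%:C *: P - Q)).
Proof.
move=> r1 rs; have r10 : r - 1 != 0 by rewrite gt_eqF// subr_gt0.
have r0 : r != 0 by rewrite gt_eqF// (lt_trans ltr01).
have sE : s = r / (r - 1).
  rewrite -[s]invrK; have -> : s^-1 = 1 - r^-1 by rewrite -rs; ring.
  by field; rewrite r0 r10.
rewrite !adjointD adjointN adjointZr; apply: bopP => x; apply: rdot_inj => z.
(* Paired with [z], both sides are real linear combinations of the same four numbers, whose
   coefficients [field] compares. *)
rewrite !(mulrDl, mulrDr, mulNr, mulrN) -!bop_scalerAl -!bop_scalerAr.
rewrite !(bopED, bopEN, bopEZ) !(rdotDl, rdotNl, rdotZl).
rewrite sE; field; exact: r10.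
Qed.

Lemma oabs_conj_sqr C X : is_adjoint X X ->
  X * oabs C ^+ 2 * X = adjoint (C * X) * (C * X).
Proof. by move=> Xsa; rewrite oabs_sqr adjointM (adjointE Xsa) !mulrA. Qed.

Lemma oabs_mul_sqr C T :
  adjoint (oabs C * T) * (oabs C * T) = adjoint (C * T) * (C * T).
Proof.
have [Csa _] := psd_oabs C.
rewrite !adjointM (adjointE Csa) -!mulrA; congr (_ * _).
by rewrite !mulrA -expr2 oabs_sqr.
Qed.

(** [|B|] and [B] have the same square modulus after right multiplication by any operator, and that
    modulus ignores the sign of the difference. *)
Lemma oabs_mulB_sqr C S T : adjoint (oabs C * (S - T)) * (oabs C * (S - T)) =
  adjoint (C * (T - S)) * (C * (T - S)).
Proof.
rewrite oabs_mul_sqr.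
have -> : C * (T - S) = - (C * (S - T)) by rewrite -(opprB S T) (mulrN C (S - T)).
by rewrite adjointN (mulrNN (adjoint (C * (S - T)))).
Qed.

Lemma bop_conj_lin S T X (r s : R[i]) :
  X * (r *: S + s *: T) * X = r *: (X * S * X) + s *: (X * T * X).
Proof.
rewrite mulrDr mulrDl -(bop_scalerAr r X) -(bop_scalerAr s X).
by rewrite -(bop_scalerAl r (X * S) X) -(bop_scalerAl s (X * T) X).
Qed.

(** Meant for [W = |A|^(1-p)], [X = |A|^(p-1)], [Y = |B|^(p-1)] and [Z = |B|^p]: right
    multiplication by [X] cancels [W] and leaves [|B| (Y - X)]. *)
Lemma oabs_conj_sub (B W X Y Z : bop H) : W * X = 1 -> Z = oabs B * Y ->
  adjoint ((Z * W - oabs B) * X) * ((Z * W - oabs B) * X) =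
  adjoint (B * (X - Y)) * (B * (X - Y)).
Proof.
move=> WX ->; rewrite -oabs_mulB_sqr.
have -> : (oabs B * Y * W - oabs B) * X = oabs B * (Y - X); last by [].
move: (oabs B) => b.
by rewrite mulrBl -(mulrA (b * Y)) WX mulr1 mulrBr.
Qed.

Lemma oabs_weighted_conj (A B W X Y Z : bop H) (r s : R[i]) :
  is_adjoint X X -> W * X = 1 -> Z = oabs B * Y ->
  X * (r *: oabs (A - B) ^+ 2 + s *: oabs (Z * W - oabs B) ^+ 2) * X =
  r *: (adjoint ((A - B) * X) * ((A - B) * X)) +
  s *: (adjoint (B * (X - Y)) * (B * (X - Y))).
Proof.
move=> Xsa WX ZbY; rewrite bop_conj_lin; congr (r *: _ + s *: _).
  exact: oabs_conj_sqr.
by rewrite -(oabs_conj_sub WX ZbY); exact: oabs_conj_sqr.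
Qed.

End Powers.

(** * The inequality and its equality case *)

Theorem theorem2p3 (R : realType) (H : hilbertType R) (A B : bop H) (r s p : R)
    (hA : invertible (oabs A)) (hB : invertible (oabs B))
    (hr : 1 < r) (hrs : r^-1 + s^-1 = 1) :
  let lhs := oabs (A * opow (oabs A) (p - 1) - B * opow (oabs B) (p - 1)) ^+ 2 in
  let rhs := opow (oabs A) (p - 1)
    * (r%:C *: oabs (A - B) ^+ 2
       + s%:C *: oabs (opow (oabs B) p * opow (oabs A) (1 - p) - oabs B) ^+ 2)
    * opow (oabs A) (p - 1) in
  ole lhs rhs /\
  (lhs = rhs <->
   (r - 1)%:C *: ((A - B) * opow (oabs A) (p - 1))
   = B * (opow (oabs A) (p - 1) - opow (oabs B) (p - 1))).
Proof.
move=> lhs rhs.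
have Apsd := psd_oabs A; have Bpsd := psd_oabs B.
pose X := opow (oabs A) (p - 1); pose Y := opow (oabs B) (p - 1).
pose P := (A - B) * X; pose Q := B * (X - Y).
have Xsa : is_adjoint X X := opow_selfadj (p - 1) Apsd hA.
have Ysa : is_adjoint Y Y := opow_selfadj (p - 1) Bpsd hB.
have lhsE : lhs = adjoint (P + Q) * (P + Q).
  by rewrite /P mulrBl /Q mulrBr subrKA -oabs_sqr.
have WX : opow (oabs A) (1 - p) * X = 1.
  by rewrite opowM// -[1 - p]opprB addNr opow0.
have bY : opow (oabs B) p = oabs B * Y.
  by rewrite -[X in X * Y](opow1 Bpsd hB) opowM// addrC subrK.
have rhsE : rhs = r%:C *: (adjoint P * P) + s%:C *: (adjoint Q * Q).
  exact: oabs_weighted_conj Xsa WX bY.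
have diffE := conjugate_exponent_identity P Q hr hrs.
rewrite -rhsE -lhsE in diffE.
have r10 : 0 < r - 1 by rewrite subr_gt0.
split; first by rewrite /ole diffE; apply: positive_adjointM; rewrite invr_ge0 ltW.
split=> [lr|E]; last first.
  by apply/esym/eqP; rewrite -subr_eq0 diffE E subrr mulr0 scaler0.
apply/eqP; rewrite -subr_eq0; apply/eqP/adjointM_eq0/eqP.
move: diffE; rewrite lr subrr => /esym/eqP; rewrite scaler_eq0 => /orP[|//].
by rewrite -[0]/(0%:C) (inj_eq (@complexI _)) invr_eq0 gt_eqF.
Qed.
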